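(* Let $\Lambda$ be a finite dimensional algebra over a field. The class $\mathcal F$ of finitely generated right $\Lambda$-modules $M$ with $\operatorname{ddell}M<\infty$ is a torsion-free class in $\mathrm{mod}\,\Lambda$ (it is closed under extensions, submodules and finite direct sums). If $\mathcal F$ contains all finitely generated $\Lambda$-modules, then $\operatorname{Findim}\Lambda^{\mathrm{op}}<\infty$.
   Context: $\mathrm{mod}\,\Lambda$ is the category of finitely generated right $\Lambda$-modules. $\mathbb N$ is the set of nonnegative integers; the infimum of the empty set is $+\infty$. $\Omega M$ is the kernel of a projective cover of $M$, $\Omega^0M=M$, $\Omega^{n+1}M=\Omega(\Omega^nM)$. ''$A$ is a direct summand of $B$ up to projective summands'' means that $A$ is isomorphic to a direct summand of $B\oplus P$ for some projective $P$. For an integer $k\ge1$, $k\text{-}\operatorname{dell}M$ is the infimum of all $n\in\mathbb N$ such that $\Omega^nM$ is a direct summand of $\Omega^{n+k}N$ up to projective summands for some $N\in\mathrm{mod}\,\Lambda$. The derived delooping level $\operatorname{ddell}M$ is the infimum of all $m\in\mathbb N$ for which there exist $0\le n\le m$ and an exact sequence $0\to C_n\to\cdots\to C_1\to C_0\to M\to0$ in $\mathrm{mod}\,\Lambda$ with $(i+1)\text{-}\operatorname{dell}C_i\le m-i$ for $i=0,\dots,n$. $\operatorname{Findim}\Lambda^{\mathrm{op}}$ is the supremum of the projective dimensions of all (not necessarily finitely generated) left $\Lambda$-modules of finite projective dimension. *)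

(* Defs.v *)
From HB Require Import structures.
From mathcomp Require Import all_boot all_order all_algebra falgebra.
From mathcomp Require Import boolp.

Set Implicit Arguments.
Unset Strict Implicit.
Unset Printing Implicit Defensive.

Import GRing.Theory.
Local Open Scope ring_scope.

(* Values in N with +oo adjoined: Some n is n and None is +oo. *)
Definition enat := option nat.

Definition enat_finite (x : enat) : bool := isSome x.

Definition enat_le (x : enat) (m : nat) : bool :=
  if x is Some n then (n <= m)%N else false.

Definition enat_inf (S : nat -> Prop) : enat :=
  if pselect (exists n, `[< S n >]) is left exS then Some (ex_minn exS)
  else None.

(* The supremum is the infimum of the upper bounds; sup of the empty set is 0. *)
Definition enat_sup (S : nat -> Prop) : enat :=
  enat_inf (fun b => forall n, S n -> (n <= b)%N).

(* Modules over R are objects of lmodType R; right modules over a ring A are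
   objects of lmodType A^c, where A^c is A with the reversed product. *)
Section Modules.
Variable R : pzRingType.
Implicit Types A B C K L M N P S X Y : lmodType R.

Definition fin_gen M : Prop :=
  exists (n : nat) (g : 'I_n -> M),
    forall x : M, exists c : 'I_n -> R, x = \sum_(i < n) c i *: g i.

Definition surj (S T : Type) (f : S -> T) : Prop := forall y, exists x, f x = y.

Definition isomorphic A B : Prop := exists f : {linear A -> B}, bijective f.

Definition exact_at A B C (f : {linear A -> B}) (g : {linear B -> C}) : Prop :=
  forall y : B, g y = 0 <-> exists x : A, f x = y.

Definition short_exact A B C (f : {linear A -> B}) (g : {linear B -> C})
    : Prop :=
  [/\ injective f, exact_at f g & surj g].

Definition projective P : Prop :=
  forall X Y (g : {linear X -> Y}) (f : {linear P -> Y}), surj g ->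
    exists h : {linear P -> X}, forall x, g (h x) = f x.

(* No proper submodule U of A satisfies U + ker f = A. *)
Definition superfluous_kernel A B (f : {linear A -> B}) : Prop :=
  forall U : {pred A}, GRing.submod_closed U ->
    (forall x, exists u k, [/\ u \in U, f k = 0 & x = u + k]) ->
    forall x, x \in U.

Definition projective_cover P M (p : {linear P -> M}) : Prop :=
  [/\ projective P, surj p & superfluous_kernel p].

(* Projective covers are unique only up to isomorphism, so K = Omega M is
   rendered as the isomorphism-invariant relation between M and K. *)
Definition is_syzygy M K : Prop :=
  exists P (i : {linear K -> P}) (p : {linear P -> M}),
    [/\ fin_gen P, projective_cover p & short_exact i p].

Fixpoint is_nth_syzygy (n : nat) M K : Prop :=
  if n is n'.+1 then exists L, is_nth_syzygy n' M L /\ is_syzygy L K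
  else isomorphic M K.

Definition is_summand A B : Prop :=
  exists A' : lmodType R, isomorphic (A * A')%type B.

Definition stable_summand A B : Prop :=
  exists P, [/\ fin_gen P, projective P & is_summand A (B * P)%type].

Definition dell (k : nat) M : enat :=
  enat_inf (fun n => exists N X Y,
    [/\ fin_gen N, is_nth_syzygy n M X, is_nth_syzygy (n + k)%N N Y
      & stable_summand X Y]).

(* An exact sequence 0 -> C_n -> ... -> C_1 -> C_0 -> M -> 0, extended on the
   left by C_i = 0 for i > n. *)
Definition resolution (n : nat) M (C : nat -> lmodType R)
    (d : forall i, {linear C i.+1 -> C i}) (e : {linear C 0%N -> M}) : Prop :=
  [/\ forall i, (n < i)%N -> forall x : C i, x = 0,
      surj e,
      exact_at (d 0%N) e
    & forall i, exact_at (d i.+1) (d i)].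

Definition ddell M : enat :=
  enat_inf (fun m => exists (n : nat) (C : nat -> lmodType R)
      (d : forall i, {linear C i.+1 -> C i}) (e : {linear C 0%N -> M}),
    [/\ (n <= m)%N,
        resolution n d e,
        forall i, (i <= n)%N -> fin_gen (C i)
      & forall i, (i <= n)%N -> enat_le (dell i.+1 (C i)) (m - i)%N]).

Definition pdim M : enat :=
  enat_inf (fun n => exists (C : nat -> lmodType R)
      (d : forall i, {linear C i.+1 -> C i}) (e : {linear C 0%N -> M}),
    resolution n d e /\ forall i, (i <= n)%N -> projective (C i)).

Definition Findim : enat :=
  enat_sup (fun n => exists M, pdim M = Some n).

Definition is_direct_sum (n : nat) (A : 'I_n -> lmodType R) S
    (iota : forall i, {linear A i -> S}) : Prop :=
  forall s : S, exists a : forall i, A i,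
    s = \sum_(i < n) iota i (a i) /\
    forall b : (forall i, A i), s = \sum_(i < n) iota i (b i) ->
      forall i, b i = a i.

(* Torsion-free classes in the category of finitely generated modules. *)
Definition torsion_free_class (F : lmodType R -> Prop) : Prop :=
  [/\ forall M, F M -> fin_gen M,
      forall A B C (f : {linear A -> B}) (g : {linear B -> C}),
        short_exact f g -> F A -> F C -> F B,
      forall N M (f : {linear N -> M}), injective f -> F M -> F N
    & forall n (A : 'I_n -> lmodType R) S (iota : forall i, {linear A i -> S}),
        is_direct_sum iota -> (forall i, F (A i)) -> F S].

Definition finite_ddell M : Prop := fin_gen M /\ enat_finite (ddell M).

End Modules.

Arguments Findim : clear implicits.

(* Main.v *)
From HB Require Import structures.
From mathcomp Require Import all_boot all_order all_algebra falgebra.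
From mathcomp Require Import ring_quotient generic_quotient.
From mathcomp Require Import boolp classical_sets functions.
Require Import Defs.

(** Since (i+1)-dell C_i need only be finite for each i (take m large), ddell M
is finite iff M has a finite resolution by modules C_i of finite (i+1)-dell;
passing to a syzygy raises the admissible delooping order k by one.

If N is a submodule of M, then 0 -> Omega M -> Omega (M/N) -> N -> 0 is exact,
and the middle term is a syzygy. If 0 -> A -> B -> C -> 0 is exact and
0 -> A' -> A_0 -> A -> 0 starts a resolution of A, then B is a quotient of
A_0 + P, P projective, by an extension of Omega C by A'; induction on the length
of the resolution of A gives closure under extensions.

Put D = Hom_K(-, K). If M has finite ddell, dimension shifting along syzygies
and resolutions gives b such that Ext^p(X, DM) = 0 whenever p > b and
pd X <= p. For M = D Lambda this reads Ext^p(X, Lambda) = 0. Every projective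
left module is a direct summand of a power of Lambda, hence
the last map of a projective resolution of X of length p splits, and
pd X < p. *)

Set Implicit Arguments.
Unset Strict Implicit.
Unset Printing Implicit Defensive.

Import GRing.Theory.
Local Open Scope ring_scope.

(** * Submodules and quotient modules, presented by linear maps *)

Section LinearMaps.
Variable R : pzRingType.
Implicit Types A B C M N P : lmodType R.

Definition mklin M N (f : M -> N) (lf : linear f) : {linear M -> N} :=
  HB.pack f (GRing.isLinear.Build R M N *:%R f lf).

Lemma linear_inj0 M N (f : {linear M -> N}) :
  (forall x, f x = 0 -> x = 0) -> injective f.
Proof.
move=> f0 x y exy; apply/eqP; rewrite -subr_eq0; apply/eqP/f0.
by rewrite linearB /= exy subrr.
Qed.

Definition submodule M (U : M -> Prop) : Prop :=
  U 0 /\ forall a x y, U x -> U y -> U (a *: x + y).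

Definition predP M (U : M -> Prop) : M -> bool := fun x => `[< U x >].

Lemma submodule_submod_closed M (U : M -> Prop) :
  submodule U -> GRing.submod_closed (predP U).
Proof.
case=> U0 UD; split; first exact/asboolP.
by move=> a x y /asboolP Ux /asboolP Uy; apply/asboolP/UD.
Qed.

Lemma ex_submodule M (U : M -> Prop) : submodule U ->
  exists (W : lmodType R) (i : {linear W -> M}),
    injective i /\ forall x, U x <-> exists w, i w = x.
Proof.
move=> /submodule_submod_closed Ucl.
pose S : submodClosed M :=
  HB.pack (predP U) (GRing.isSubmodClosed.Build R M _ Ucl).
pose W1 := {x : M | x \in S}.
pose mix := [SubChoice_isSubLmodule of W1 by <:].
pose W : lmodType R := HB.pack W1 mix.
exists W.
have lv : linear (val : W -> M) by move=> a x y.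
exists (mklin lv); split; first exact: val_inj.
move=> x; split=> [Ux|[w <-]].
  have xS : x \in S by apply/asboolP.
  by exists (exist _ x xS).
exact/asboolP/(svalP w).
Qed.

Section Quotient.
Variables (M : lmodType R) (U : M -> bool) (Ucl : GRing.submod_closed U).
Let Uz := GRing.submod_closedB Ucl.
Let S : zmodClosed M := HB.pack U (GRing.isZmodClosed.Build M U Uz).
Local Open Scope quotient_scope.

Definition quotmod := Quotient.quot S.
HB.instance Definition _ := GRing.Zmodule.on quotmod.

Definition quot_pi (x : M) : quotmod := \pi_(Quotient.quot S) x.

Lemma quot_piP (v : quotmod) : exists x, v = quot_pi x.
Proof. by exists (repr v); rewrite /quot_pi reprK. Qed.

Lemma quot_pi_eq x y : quot_pi x = quot_pi y <-> x - y \in U.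
Proof.
rewrite -[_ \in U]/(_ \in S) Quotient.idealrBE.
by split=> [e|/eqP //]; apply/eqP.
Qed.

Lemma quot_piD x y : quot_pi (x + y) = quot_pi x + quot_pi y.
Proof. exact: Quotient.pi_add. Qed.

Definition quot_scale (a : R) (v : quotmod) : quotmod :=
  quot_pi (a *: repr v).

Lemma quot_scaleE a x : quot_scale a (quot_pi x) = quot_pi (a *: x).
Proof.
apply/quot_pi_eq; rewrite -scalerBr.
have [U0 UD] := Ucl; rewrite -[_ *: _]addr0; apply: (UD) => //.
by apply/quot_pi_eq; rewrite {1}/quot_pi reprK.
Qed.

Lemma quot_scaleA a b v : quot_scale a (quot_scale b v) = quot_scale (a * b) v.
Proof. by have [x ->] := quot_piP v; rewrite !quot_scaleE scalerA. Qed.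

Lemma quot_scale1 : left_id 1 quot_scale.
Proof. by move=> v; have [x ->] := quot_piP v; rewrite quot_scaleE scale1r. Qed.

Lemma quot_scaleDr : right_distributive quot_scale +%R.
Proof.
move=> a u v; have [x ->] := quot_piP u; have [y ->] := quot_piP v.
by rewrite -quot_piD !quot_scaleE scalerDr quot_piD.
Qed.

Lemma quot_scaleDl v : {morph quot_scale^~ v : a b / a + b}.
Proof.
move=> a b; have [x ->] := quot_piP v.
by rewrite !quot_scaleE scalerDl quot_piD.
Qed.

HB.instance Definition _ := GRing.Zmodule_isLmodule.Build R quotmod
  quot_scaleA quot_scale1 quot_scaleDr quot_scaleDl.
End Quotient.

Lemma ex_quotient M (U : M -> Prop) : submodule U ->
  exists (W : lmodType R) (q : {linear M -> W}),
    surj q /\ forall x, q x = 0 <-> U x.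
Proof.
move=> /submodule_submod_closed Ucl; exists (quotmod Ucl).
have lp : linear (quot_pi Ucl).
  by move=> a x y; rewrite quot_piD -quot_scaleE.
exists (mklin lp); split=> [v|x].
  by have [x ->] := quot_piP v; exists x.
have <- : quot_pi Ucl 0 = 0 by exact: (linear0 (mklin lp)).
rewrite (quot_pi_eq Ucl x 0) subr0.
by split=> [/asboolP //|Ux]; apply/asboolP.
Qed.
End LinearMaps.

(** * Projective, free and finitely generated modules *)

Section Projectives.
Variable R : pzRingType.
Implicit Types A B C K L M N P Q S X Y : lmodType R.

(** The universal property of a subobject: preimages under [i] are unique, so a choice of them is
    automatically linear. *)
Lemma linear_factor A B X (i : {linear A -> B}) (h : {linear X -> B}) :
  injective i -> (forall x, exists a, i a = h x) ->
  exists h' : {linear X -> A}, forall x, i (h' x) = h x.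
Proof.
move=> i_inj /choice[h' h'E].
have lh' : linear h'.
  by move=> a x y; apply: i_inj; rewrite linearP !h'E linearP.
by exists (mklin lh').
Qed.

Lemma linear_inverse A B (f : {linear A -> B}) : injective f -> surj f ->
  exists g : {linear B -> A}, cancel f g /\ cancel g f.
Proof.
move=> f_inj f_surj.
have [g gE] := linear_factor (h := idfun : {linear B -> B}) f_inj f_surj.
by exists g; split=> // x; apply: f_inj; rewrite gE.
Qed.

Lemma isomorphic_cancel A B : isomorphic A B ->
  exists (f : {linear A -> B}) (g : {linear B -> A}), cancel f g /\ cancel g f.
Proof.
case=> f [g0 fK gK]; exists f.
by apply: linear_inverse => [|y]; [exact: can_inj fK | exists (g0 y)].
Qed.

Lemma isomorphic_refl A : isomorphic A A.
Proof. by exists (idfun : {linear A -> A}); exists idfun. Qed.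

Lemma linear_descend A B X (g : {linear A -> B}) (h : {linear A -> X}) :
  surj g -> (forall x, g x = 0 -> h x = 0) ->
  exists h' : {linear B -> X}, forall x, h' (g x) = h x.
Proof.
move=> /choice[s sE] gh0.
have hsg x : h (s (g x)) = h x.
  apply/eqP; rewrite -subr_eq0 -linearB; apply/eqP/gh0.
  by rewrite linearB /= sE subrr.
have ls : linear (fun y => h (s y)).
  move=> a x y; rewrite -{1}[x]sE -{1}[y]sE -linearP hsg.
  by rewrite linearP.
by exists (mklin ls).
Qed.

Lemma ex_kernel B C (g : {linear B -> C}) :
  exists A (f : {linear A -> B}), injective f /\ exact_at f g.
Proof.
have [|A [f [fI fE]]] := @ex_submodule R B (fun x => g x = 0).
  split=> [|a x y gx gy]; first exact: linear0.
  by rewrite linearP gx gy scaler0 addr0.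
by exists A, f.
Qed.

Lemma ex_image A B (f : {linear A -> B}) :
  exists C (g : {linear A -> C}) (i : {linear C -> B}),
    [/\ surj g, injective i & forall x, i (g x) = f x].
Proof.
have [|C [i [iI iE]]] := @ex_submodule R B (fun y => exists x, f x = y).
  split=> [|a _ _ [x <-] [y <-]]; first by exists 0; rewrite linear0.
  by exists (a *: x + y); rewrite linearP.
have [|g gE] := linear_factor (h := f) iI.
  by move=> x; apply/iE; exists x.
exists C, g, i; split=> // c.
have [|x xc] := (iE (i c)).2; first by exists c.
by exists x; apply: iI; rewrite gE.
Qed.

Definition linear_pair X A B (f : {linear X -> A}) (g : {linear X -> B}) :
  {linear X -> (A * B)%type} :=
  mklin (f := fun x => (f x, g x))
    (fun a x y => congr2 pair (linearP f a x y) (linearP g a x y)).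

Lemma linear_fst_proof A B : linear (fst : (A * B)%type -> A).
Proof. by []. Qed.

Lemma linear_snd_proof A B : linear (snd : (A * B)%type -> B).
Proof. by []. Qed.

Definition lin_fst A B : {linear (A * B)%type -> A} :=
  mklin (@linear_fst_proof A B).

Definition lin_snd A B : {linear (A * B)%type -> B} :=
  mklin (@linear_snd_proof A B).

Definition linear_copair X A B (f : {linear A -> X}) (g : {linear B -> X}) :
  {linear (A * B)%type -> X} :=
  (f \o lin_fst A B) \+ (g \o lin_snd A B).

Lemma short_exact_prod A B :
  short_exact (linear_pair (idfun : {linear A -> A}) (\0 : {linear A -> B}))
    (lin_snd A B).
Proof.
split=> [x y [] //|[a b]|b]; last by exists (0, b).
by split=> /= [->|[x [_ <-]] //]; exists a.
Qed.

Lemma projective_retract P Q (f : {linear P -> Q}) (g : {linear Q -> P}) :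
  cancel f g -> projective Q -> projective P.
Proof.
move=> fK projQ X Y u v us.
have [h hE] := projQ X Y u (v \o g : {linear Q -> Y}) us.
by exists (h \o f : {linear P -> X}) => x; rewrite /= hE /= fK.
Qed.

Lemma projective_prod P Q :
  projective P -> projective Q -> projective (P * Q)%type.
Proof.
move=> pP pQ X Y u v us.
have [h hE] := pP X Y u
  (v \o linear_pair (idfun : {linear P -> P}) (\0 : {linear P -> Q})
    : {linear P -> Y}) us.
have [k kE] := pQ X Y u
  (v \o linear_pair (\0 : {linear Q -> P}) (idfun : {linear Q -> Q})
    : {linear Q -> Y}) us.
exists (linear_copair h k) => -[x y] /=.
by rewrite linearD hE kE /= -linearD; congr (v (_, _)); rewrite ?addr0 ?add0r.
Qed.

Lemma projective_trivial P : (forall x : P, x = 0) -> projective P.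
Proof.
move=> P0 X Y u v us; exists (\0 : {linear P -> X}) => x.
by rewrite (P0 x) !linear0.
Qed.

(** The coordinate vector at [i]. The index type may be infinite, because powers indexed by a whole
    module occur later. *)
Definition unit_fun (I : eqType) (i : I) : I -> R^o := fun j => (i == j)%:R.

Lemma scale_unit_funE (I : eqType) a (i j : I) :
  (a *: unit_fun i) j = a * (i == j)%:R.
Proof. by []. Qed.

Lemma free_sum n (c : 'I_n -> R^o) : c = \sum_i (c i : R) *: unit_fun i.
Proof.
apply/funext => j; rewrite fct_sumE (bigD1 j) //= big1 => [|i /negPf ij].
  by rewrite scale_unit_funE eqxx mulr1 addr0.
by rewrite scale_unit_funE ij mulr0.
Qed.

Lemma linear_free_proof n M (g : 'I_n -> M) :
  linear (fun c : 'I_n -> R^o => \sum_i (c i : R) *: g i).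
Proof.
move=> a c d; rewrite scaler_sumr -big_split; apply: eq_bigr => i _.
by rewrite scalerDl scalerA.
Qed.

Lemma free_projective n : projective ('I_n -> R^o).
Proof.
move=> X Y u v us.
have [x xE] := choice (fun i : 'I_n => us (v (unit_fun i))).
exists (mklin (linear_free_proof x)) => c.
rewrite linear_sum [in RHS](free_sum c) linear_sum.
by apply: eq_bigr => i _; rewrite !linearZ /= xE.
Qed.

Lemma free_fin_gen n : fin_gen ('I_n -> R^o).
Proof.
exists n, (@unit_fun 'I_n) => c; exists c; exact: free_sum.
Qed.

Lemma ex_projective_onto M : fin_gen M ->
  exists P (p : {linear P -> M}), [/\ fin_gen P, projective P & surj p].
Proof.
case=> n [g gE]; exists ('I_n -> R^o), (mklin (linear_free_proof g)).
split; [exact: free_fin_gen | exact: free_projective |].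
by move=> x; have [c ->] := gE x; exists c.
Qed.

Lemma fin_gen_surj M N (f : {linear M -> N}) : surj f -> fin_gen M -> fin_gen N.
Proof.
move=> fs [n [g gE]]; exists n, (fun i => f (g i)) => y.
have [x <-] := fs y; have [c ->] := gE x; exists c.
by rewrite linear_sum; apply: eq_bigr => i _; rewrite linearZ.
Qed.

Lemma fin_gen_ext A B C (f : {linear A -> B}) (g : {linear B -> C}) :
  short_exact f g -> fin_gen A -> fin_gen C -> fin_gen B.
Proof.
move=> [_ fg gs] [m [a aE]] [n [c cE]].
have [b bE] := choice (fun i => gs (c i)).
exists (m + n)%N, (fun i => match fintype.split i with inl j => f (a j)
                                             | inr j => b j end) => x.
have [s sE] := cE (g x).
have [|y yE] := (fg (x - \sum_i s i *: b i)).1.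
  rewrite linearB linear_sum /= sE; apply/eqP; rewrite subr_eq0; apply/eqP.
  by apply: eq_bigr => i _; rewrite linearZ /= bE.
have [r rE] := aE y.
exists (fun i => match fintype.split i with inl j => r j | inr j => s j end).
rewrite big_split_ord /=.
under eq_bigr => i _ do rewrite (unsplitK (inl i)).
under [X in _ + X]eq_bigr => i _ do rewrite (unsplitK (inr i)).
rewrite -[x in LHS](subrK (\sum_i s i *: b i)) -yE rE linear_sum.
by congr (_ + _); apply: eq_bigr => i _; rewrite linearZ.
Qed.

Lemma fin_gen_prod A B : fin_gen A -> fin_gen B -> fin_gen (A * B)%type.
Proof. exact: fin_gen_ext (short_exact_prod A B). Qed.

End Projectives.

(** * Syzygies over arbitrary projectives, and stable retracts *)

Section Syzygies.
Variable R : pzRingType.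
Implicit Types A B C K L M N P Q S X Y Z : lmodType R.

(* Unlike is_syzygy, this does not ask P -> M to be a projective cover. *)
Definition syz M K : Prop :=
  exists P (i : {linear K -> P}) (p : {linear P -> M}),
    [/\ fin_gen P, projective P & short_exact i p].

(** The recursion peels off the first syzygy, whereas [is_nth_syzygy] peels off the last; this suits
    inductions in which [M] varies. *)
Fixpoint nsyz n M K : Prop :=
  if n is n'.+1 then exists L, syz M L /\ nsyz n' L K else isomorphic M K.

Lemma syz_iso M M' K : isomorphic M M' -> syz M' K -> syz M K.
Proof.
move=> /isomorphic_cancel[f [g [fK gK]]] [P [i [p [fgP pP [iI ip ps]]]]].
exists P, i, (g \o p : {linear P -> M}); split=> //; split=> // [x|y] /=.
  by rewrite -ip /= -(linear0 g); split=> [/(can_inj gK)|->].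
by have [x xE] := ps (f y); exists x; rewrite xE fK.
Qed.

Lemma nsyz_rcons n M L K : nsyz n M L -> syz L K -> nsyz n.+1 M K.
Proof.
elim: n M => [|n IHn] M /= => [iML sLK|[X [sMX nXL]] sLK].
  by exists K; split; [exact: syz_iso iML sLK | exact: isomorphic_refl].
by exists X; split=> //; apply: IHn nXL sLK.
Qed.

Lemma is_syzygy_syz M K : is_syzygy M K -> syz M K.
Proof. by case=> P [i [p [fgP [pP _ _] ex]]]; exists P, i, p. Qed.

Lemma is_nth_syzygy_nsyz n M K : is_nth_syzygy n M K -> nsyz n M K.
Proof.
elim: n K => //= n IHn K [L [nL /is_syzygy_syz sLK]].
exact: nsyz_rcons (IHn _ nL) sLK.
Qed.

Lemma ex_syz M : fin_gen M -> exists K, syz M K.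
Proof.
move=> /ex_projective_onto[P [p [fgP pP ps]]].
by have [K [i [iI ip]]] := ex_kernel p; exists K, P, i, p.
Qed.

(* M is a direct summand of N up to projective summands: the identity of M
   factors through N modulo maps that factor through a projective. *)
Definition stable_retract M N : Prop :=
  exists (f : {linear M -> N}) (g : {linear N -> M}) Q
         (a : {linear M -> Q}) (b : {linear Q -> M}),
    [/\ fin_gen Q, projective Q & forall x, g (f x) + b (a x) = x].

Lemma retract_stable_retract M N (f : {linear M -> N}) (g : {linear N -> M}) :
  cancel f g -> stable_retract M N.
Proof.
move=> fK; exists f, g, ('I_0 -> R^o), \0, \0.
split=> [||x]; [exact: free_fin_gen | exact: free_projective |].
by rewrite /= addr0.
Qed.

Lemma stable_retract_refl M : stable_retract M M.
Proof. exact: (@retract_stable_retract M M idfun idfun). Qed.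

Lemma isomorphic_stable_retract M N : isomorphic M N ->
  stable_retract M N /\ stable_retract N M.
Proof.
move=> /isomorphic_cancel[f [g [fK gK]]].
by split; [exact: retract_stable_retract fK | exact: retract_stable_retract gK].
Qed.

Lemma stable_retract_trans M N L :
  stable_retract M N -> stable_retract N L -> stable_retract M L.
Proof.
move=> [f [g [Q [a [b [fgQ pQ e]]]]]] [f' [g' [Q' [a' [b' [fgQ' pQ' e']]]]]].
exists (f' \o f), (g \o g'), (Q' * Q)%type, (linear_pair (a' \o f) a).
exists (linear_copair (g \o b') b).
split; [exact: fin_gen_prod | exact: projective_prod | move=> x /=].
by rewrite addrA -linearD e'.
Qed.

Lemma stable_retract_prod_projective M P : fin_gen P -> projective P ->
  stable_retract (M * P)%type M.
Proof.
move=> fgP pP; exists (lin_fst M P), (linear_pair idfun \0), P, (lin_snd M P).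
exists (linear_pair \0 idfun); split=> // -[x y].
by congr (_, _) => /=; rewrite ?addr0 ?add0r.
Qed.

(** The given maps assemble to [u] from [M] to [N + Q] and [v] back with [v u] the identity, so
    [N + Q] is [M] plus the kernel of [v]. *)
Lemma stable_retract_summand M N : stable_retract M N -> stable_summand M N.
Proof.
move=> [f [g [Q [a [b [fgQ pQ e]]]]]]; exists Q; split=> //.
pose u : {linear M -> (N * Q)%type} := linear_pair f a.
pose v : {linear (N * Q)%type -> M} := linear_copair g b.
have vu x : v (u x) = x by exact: e.
have [A' [i [iI iv]]] := ex_kernel v.
exists A', (linear_copair u i).
have [|w wE] := linear_factor
    (h := idfun \- (u \o v) : {linear (N * Q)%type -> (N * Q)%type}) iI.
  by move=> y; apply/iv; rewrite linearB vu subrr.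
have vi y : v (i y) = 0 by apply/iv; exists y.
exists (linear_pair v w).
  move=> [x y]; rewrite -[linear_copair u i _]/(u x + i y).
  have vE : v (u x + i y) = x by rewrite linearD vi vu addr0.
  congr (_, _); first exact: vE.
  apply: iI; rewrite wE -[LHS]/(u x + i y - u (v (u x + i y))) vE.
  by rewrite addrC addKr.
move=> y; rewrite -[LHS]/(u (v y) + i (w y)) wE.
by rewrite -[X in _ + X]/(y - u (v y)) addrC subrK.
Qed.

Lemma summand_stable_retract M N : stable_summand M N -> stable_retract M N.
Proof.
move=> [P [fgP pP [A' /isomorphic_cancel[f [g [fK gK]]]]]].
apply: stable_retract_trans (stable_retract_prod_projective N fgP pP).
apply: (@retract_stable_retract _ _ (f \o linear_pair idfun \0)
         (lin_fst M A' \o g)).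
by move=> x /=; rewrite fK.
Qed.

(** A stable form of Schanuel's lemma. Lift [f], [g], [b] to maps [F], [G], [b'] into the
    projectives. The identity of [P] minus [G F + b' a p] is killed by [p], so it lands in [K];
    restricted to [K] it is the part of the identity that factors through [P]. *)
Lemma syz_stable_retract M M' K K' :
  stable_retract M M' -> syz M K -> syz M' K' -> stable_retract K K'.
Proof.
move=> [f [g [Q [a [b [fgQ pQ e]]]]]] [P [i [p [fgP pP [iI ip ps]]]]].
move=> [P' [i' [p' [fgP' pP' [iI' ip' ps']]]]].
have pi k : p (i k) = 0 by apply/ip; exists k.
have pi' k : p' (i' k) = 0 by apply/ip'; exists k.
have [F FE] := pP P' M' p' (f \o p : {linear P -> M'}) ps'.
have [G GE] := pP' P M p (g \o p' : {linear P' -> M}) ps.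
have [b' b'E] := pQ P M p b ps.
have [|f1 f1E] := linear_factor (h := F \o i : {linear K -> P'}) iI'.
  by move=> k; apply/ip'; rewrite FE /= pi linear0.
have [|g1 g1E] := linear_factor (h := G \o i' : {linear K' -> P}) iI.
  by move=> k; apply/ip; rewrite GE /= pi' linear0.
have [|s sE] := linear_factor
    (h := idfun \- ((G \o F) \+ (b' \o (a \o p))) : {linear P -> P}) iI.
  move=> x; apply/ip; rewrite linearB linearD /= GE /= FE /= b'E e.
  by rewrite subrr.
exists f1, g1, P, i, s; split=> // k; apply: iI.
rewrite linearD g1E /= f1E /= sE /= pi !linear0 addr0.
by rewrite addrC subrK.
Qed.

Lemma nsyz_stable_retract n M M' K K' :
  stable_retract M M' -> nsyz n M K -> nsyz n M' K' -> stable_retract K K'.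
Proof.
elim: n M M' => [|n IHn] M M' /= rM.
  move=> /isomorphic_stable_retract[_ rKM] /isomorphic_stable_retract[rM' _].
  exact: stable_retract_trans rKM (stable_retract_trans rM rM').
move=> [L [sL nL]] [L' [sL' nL']].
exact: IHn (syz_stable_retract rM sL sL') nL nL'.
Qed.

(** A lift [s] of [p] to [B] gives the surjection [f q + s] from [A0 + P] to [B]. Its kernel [Z]
    projects onto [K] inside [P], and the kernel of that projection is the kernel of [q], namely
    [A']. *)
Lemma ex_horseshoe A B C A' A0 K P
    (f : {linear A -> B}) (g : {linear B -> C})
    (k : {linear A' -> A0}) (q : {linear A0 -> A})
    (i : {linear K -> P}) (p : {linear P -> C}) :
  short_exact f g -> short_exact k q -> short_exact i p -> projective P ->
  exists Z (z : {linear Z -> (A0 * P)%type}) (r : {linear (A0 * P)%type -> B})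
         (u : {linear A' -> Z}) (v : {linear Z -> K}),
    short_exact z r /\ short_exact u v.
Proof.
move=> [fI fg gs] [kI kq qs] [iI ip ps] pP.
have gf x : g (f x) = 0 by apply/fg; exists x.
have qk x : q (k x) = 0 by apply/kq; exists x.
have [s sE] := pP B C g p gs.
pose r : {linear (A0 * P)%type -> B} := linear_copair (f \o q) s.
have [Z [z [zI zr]]] := ex_kernel r.
have rz x : f (q (z x).1) + s (z x).2 = 0 by apply/(zr (z x)); exists x.
have [|u uE] := linear_factor (h := linear_pair k \0) zI.
  by move=> x; apply/zr; rewrite /= qk !linear0 addr0.
have [|v vE] := linear_factor (h := lin_snd A0 P \o z : {linear Z -> P}) iI.
  move=> x; apply/ip; have /(congr1 g) := rz x.
  by rewrite linearD /= gf add0r sE linear0.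
exists Z, z, r, u, v; split; split=> //.
- move=> b; have [x xE] := ps (g b).
  have [|y yE] := (fg (b - s x)).1; first by rewrite linearB /= sE xE subrr.
  by have [w wE] := qs y; exists (w, x); rewrite /= wE yE subrK.
- move=> x y exy; apply: kI.
  by have := congr1 z exy; rewrite !uE => -[].
- move=> x; split=> [vx|[y <-]].
    have zx2 : (z x).2 = 0 by rewrite -[LHS]vE vx linear0.
    have := rz x; rewrite zx2 linear0 addr0 -(linear0 f) => /fI/kq[y yE].
    by exists y; apply: zI; rewrite uE /= yE -zx2; case: (z x).
  by apply: iI; rewrite vE /= uE /= linear0.
move=> y; have [|x xE] := (fg (s (i y))).1.
  by rewrite sE; apply/ip; exists y.
(* A preimage of [- x] in [A0] cancels [s (i y) = f x], which puts the pair in [Z]. *)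
have [w wE] := qs (- x).
have [|t tE] := (zr (w, i y)).1; first by rewrite /= wE linearN xE addNr.
by exists t; apply: iI; rewrite vE /= tE.
Qed.

Lemma short_exact_trivial_left A B C (f : {linear A -> B})
    (g : {linear B -> C}) :
  short_exact f g -> (forall x : A, x = 0) -> isomorphic B C.
Proof.
move=> [fI fg gs] A0; exists g.
have gI : injective g.
  by apply: linear_inj0 => x /fg[a <-]; rewrite (A0 a) linear0.
by have [h [gK hK]] := linear_inverse gI gs; exists h.
Qed.

End Syzygies.

(** * Infima in the extended natural numbers *)

Lemma enat_inf_finite (S : nat -> Prop) :
  enat_finite (enat_inf S) <-> exists n, S n.
Proof.
rewrite /enat_inf; case: pselect => [exS|nS]; split=> //.
  by move=> _; case: exS => n /asboolP; exists n.
by case=> n Sn; case: nS; exists n; apply/asboolP.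
Qed.

Lemma enat_inf_Some (S : nat -> Prop) n :
  enat_inf S = Some n -> S n /\ forall m, S m -> (n <= m)%N.
Proof.
rewrite /enat_inf; case: pselect => // exS [<-].
case: ex_minnP => m /asboolP Sm mmin; split=> // k Sk.
exact/mmin/asboolP.
Qed.

(** * Resolutions cut into short exact sequences *)

Section Resolved.
Variable R : pzRingType.
Implicit Types (C M N : lmodType R) (F : nat -> lmodType R -> Prop).

(** The term in degree [i] has to satisfy [F (j + i)]; with [j = 1] this matches a condition on the
    (i+1)-dell of the i-th term. *)
Fixpoint resolved F j n M : Prop :=
  if n is n'.+1 then
    exists C M' (f : {linear M' -> C}) (g : {linear C -> M}),
      [/\ short_exact f g, F j C & resolved F j.+1 n' M']
  else F j M.

Definition iso_invariant F : Prop :=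
  forall j M N, isomorphic M N -> F j N -> F j M.

Lemma resolved_iso F j n M N : iso_invariant F ->
  isomorphic M N -> resolved F j n N -> resolved F j n M.
Proof.
move=> Fiso iMN; case: n => [|n] /=; first exact: Fiso.
have [u [v [uK vK]]] := isomorphic_cancel iMN.
move=> [C [M' [f [g [[fI fg gs] FC rM']]]]].
exists C, M', f, (v \o g : {linear C -> M}); split=> //; split=> // [x|y] /=.
  by rewrite -fg -(linear0 v); split=> [/(can_inj vK)|->].
by have [x xE] := gs (u y); exists x; rewrite xE uK.
Qed.

Lemma resolution_kernel n M (C : nat -> lmodType R)
    (d : forall i, {linear C i.+1 -> C i}) (e : {linear C 0%N -> M}) :
  resolution n.+1 d e ->
  exists M' (f : {linear M' -> C 0%N}) (e' : {linear C 1%N -> M'}),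
    short_exact f e /\ resolution n (C := fun i => C i.+1) (fun i => d i.+1) e'.
Proof.
move=> [C0 es de dd]; have [M' [f [fI fe]]] := ex_kernel e.
have [|e' e'E] := linear_factor (h := d 0%N) fI.
  by move=> x; apply/fe/de; exists x.
exists M', f, e'; split=> //; split=> [i ni x|y|x|i].
- exact: C0.
- have [|x xE] := (de (f y)).1; first by apply/fe; exists y.
  by exists x; apply: fI; rewrite e'E.
- rewrite -dd -e'E; split=> [->|]; first exact: linear0.
  by rewrite -(linear0 f) => /fI.
exact: dd.
Qed.

Lemma resolution_resolved F j n M (C : nat -> lmodType R)
    (d : forall i, {linear C i.+1 -> C i}) (e : {linear C 0%N -> M}) :
  iso_invariant F -> resolution n d e ->
  (forall i, (i <= n)%N -> F (j + i)%N (C i)) -> resolved F j n M.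
Proof.
move=> Fiso; elim: n j M C d e => [|n IHn] j M C d e.
  move=> [C0 es de _] /(_ 0%N isT); rewrite addn0 /=; apply: Fiso.
  have eI : injective e.
    by apply: linear_inj0 => x /de[y <-]; rewrite (C0 _ _ y) ?linear0.
  have [h [eK hK]] := linear_inverse eI es.
  by exists h; exists e.
move=> re FC; have [M' [f [e' [fe re']]]] := resolution_kernel re.
exists (C 0%N), M', f, e; split=> //.
  by have := FC 0%N isT; rewrite addn0.
by apply: (IHn j.+1 M' _ _ _ re') => i ni; rewrite addSnnS; apply: FC.
Qed.

Definition shift_term C (D : nat -> lmodType R) (i : nat) : lmodType R :=
  if i is i'.+1 then D i' else C.

Definition shift_map C (D : nat -> lmodType R)
    (d : forall i, {linear D i.+1 -> D i}) (d0 : {linear D 0%N -> C})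
    (i : nat) :
    {linear shift_term C D i.+1 -> shift_term C D i} :=
  match i with 0%N => d0 | i'.+1 => d i' end.

Lemma resolved_resolution F j n M : resolved F j n M ->
  exists (C : nat -> lmodType R) (d : forall i, {linear C i.+1 -> C i})
         (e : {linear C 0%N -> M}),
    resolution n d e /\ forall i, (i <= n)%N -> F (j + i)%N (C i).
Proof.
elim: n j M => [|n IHn] j M /=.
  move=> FM; pose Z : lmodType R := 'I_0 -> R^o.
  have Z0 (x : Z) : x = 0 by apply/funext=> -[].
  pose d0 : {linear Z -> M} := \0.
  pose dz (i : nat) : {linear Z -> Z} := \0.
  exists (shift_term M (fun=> Z)), (@shift_map M (fun=> Z) dz d0), idfun.
  split; last by case=> // _; rewrite addn0.
  split=> [[|i] //|y|y|[|i] y].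
  - by exists y.
  - by split=> [y0|[x <-]] //; exists 0; apply: esym.
  - by rewrite /= (Z0 y); split=> // _; exists 0; rewrite linear0.
  by rewrite /= (Z0 y); split=> // _; exists 0; rewrite linear0.
move=> [C0 [M' [f [g [[fI fg gs] FC /IHn[D [d [e [[D0 es de dd] FD]]]]]]]]].
exists (shift_term C0 D), (shift_map d (f \o e)), g; split; last first.
  by case=> [|i] ni; rewrite ?addn0 //= addnS -addSn; apply: FD.
split=> [[|i] // ni x|//|y|[|i] y]; first exact: D0.
- rewrite fg; split=> [[x <-]|[x <-]]; last by exists (e x).
  by have [w <-] := es x; exists w.
- by rewrite /= -de -(linear0 f); split=> [/fI|->].
exact: dd.
Qed.

End Resolved.

(** * Finite derived delooping level, given noetherianity and projective covers *)

Section DerivedDelooping.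
Variable R : pzRingType.
Implicit Types A B C K L M N P Q S X Y Z : lmodType R.

Hypothesis noeth : forall N M (f : {linear N -> M}),
  injective f -> fin_gen M -> fin_gen N.
Hypothesis covers : forall M, fin_gen M ->
  exists P (p : {linear P -> M}), fin_gen P /\ projective_cover p.

Lemma fin_gen_syz M K : syz M K -> fin_gen K.
Proof. by case=> P [i [p [fgP _ [iI _ _]]]]; apply: noeth iI fgP. Qed.

Lemma ex_is_nth_syzygy n M : fin_gen M ->
  exists K, is_nth_syzygy n M K /\ fin_gen K.
Proof.
move=> fgM; elim: n => [|n [L [nL fgL]]].
  by exists M; split=> //; exact: isomorphic_refl.
have [P [p [fgP pc]]] := covers fgL; have [_ ps _] := pc.
have [K [i [iI ip]]] := ex_kernel p.
exists K; split; last exact: noeth iI fgP.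
by exists L; split=> //; exists P, i, p.
Qed.

(** For finitely generated [C], finiteness of the j-dell, expressed with syzygies over arbitrary
    projectives, which are easier to construct than minimal ones. *)
Definition deloops j C : Prop :=
  exists m N X Y, [/\ fin_gen N, nsyz m C X, nsyz (m + j) N Y
                    & stable_retract X Y].

(** Minimal and arbitrary m-th syzygies of one module are stable retracts of each other, so either
    kind can witness the condition. *)
Lemma deloopsP j C : fin_gen C -> enat_finite (dell j C) <-> deloops j C.
Proof.
move=> fgC; rewrite /dell enat_inf_finite; split.
  move=> [m [N [X [Y [fgN /is_nth_syzygy_nsyz nX /is_nth_syzygy_nsyz nY]]]]].
  by move=> /summand_stable_retract XY; exists m, N, X, Y.
move=> [m [N [X [Y [fgN nX nY XY]]]]]; exists m, N.
have [X' [nX' _]] := ex_is_nth_syzygy m fgC.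
have [Y' [nY' _]] := ex_is_nth_syzygy (m + j) fgN.
exists X', Y'; split=> //; apply: stable_retract_summand.
have rX := nsyz_stable_retract (stable_retract_refl C)
  (is_nth_syzygy_nsyz nX') nX.
have rY := nsyz_stable_retract (stable_retract_refl N) nY
  (is_nth_syzygy_nsyz nY').
exact: stable_retract_trans rX (stable_retract_trans XY rY).
Qed.

Lemma ex_nsyz n M : fin_gen M -> exists K, nsyz n M K /\ fin_gen K.
Proof.
move=> /(ex_is_nth_syzygy n)[K [/is_nth_syzygy_nsyz nK fgK]].
by exists K.
Qed.

Lemma fin_gen_nsyz n M K : fin_gen M -> nsyz n M K -> fin_gen K.
Proof.
elim: n M => [|n IHn] M fgM /=.
  move=> /isomorphic_cancel[f [g [fK gK]]].
  by apply: (fin_gen_surj (f := f)) fgM => y; exists (g y).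
by move=> [L [/fin_gen_syz fgL]]; apply: IHn.
Qed.

Lemma deloops_stable_retract j C C' : fin_gen C ->
  stable_retract C C' -> deloops j C' -> deloops j C.
Proof.
move=> fgC rC [m [N [X' [Y [fgN nX' nY rXY]]]]].
have [X [nX _]] := ex_nsyz m fgC; exists m, N, X, Y; split=> //.
exact: stable_retract_trans (nsyz_stable_retract rC nX nX') rXY.
Qed.

(** Taking one more syzygy on both sides of the stable retract raises the order by one, with the
    same [m] and [N]. *)
Lemma deloops_syz j C C1 : fin_gen C ->
  deloops j C -> syz C C1 -> deloops j.+1 C1.
Proof.
move=> fgC [m [N [X [Y [fgN nX nY rXY]]]]] sC.
have [X1 [nX1 _]] := ex_nsyz m (fin_gen_syz sC).
have [X2 sX2] := ex_syz (fin_gen_nsyz fgC nX).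
have [Y1 sY1] := ex_syz (fin_gen_nsyz fgN nY).
exists m, N, X1, Y1; split=> //.
  by rewrite addnS; apply: nsyz_rcons nY sY1.
have nX1' : nsyz m.+1 C X1 by exists C1.
have r12 := nsyz_stable_retract (stable_retract_refl C) nX1'
  (nsyz_rcons nX sX2).
exact: stable_retract_trans r12 (syz_stable_retract rXY sX2 sY1).
Qed.

(** The witness is [m = 0]: [K] itself is already a first syzygy. *)
Lemma syz_deloops M K : fin_gen M -> syz M K -> deloops 1 K.
Proof.
move=> fgM sMK; exists 0%N, M, K, K; split=> //.
- exact: isomorphic_refl.
- by exists K; split=> //; exact: isomorphic_refl.
exact: stable_retract_refl.
Qed.

Definition fg_deloops j C : Prop := fin_gen C /\ deloops j C.

Lemma fg_deloops_iso : iso_invariant fg_deloops.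
Proof.
move=> j M N iMN [fgN dN].
have [f [g [fK gK]]] := isomorphic_cancel iMN.
have fgM : fin_gen M.
  by apply: (fin_gen_surj (f := g)) fgN => x; exists (f x).
split=> //; have [rMN _] := isomorphic_stable_retract iMN.
exact: deloops_stable_retract rMN dN.
Qed.

Lemma finite_ddellP M :
  finite_ddell M <-> exists n, resolved fg_deloops 1 n M.
Proof.
rewrite /finite_ddell /ddell enat_inf_finite; split.
  move=> [fgM [m [n [C [d [e [nm re fgC dC]]]]]]]; exists n.
  apply: (resolution_resolved fg_deloops_iso re) => i ni.
  split; first exact: fgC.
  by apply/deloopsP; [exact: fgC | have := dC i ni; case: dell].
move=> [n /resolved_resolution[C [d [e [re FC]]]]].
have fgC i : (i <= n)%N -> fin_gen (C i) by move=> /FC[].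
have [_ es _ _] := re.
split; first exact: fin_gen_surj es (fgC 0%N isT).
(* The default 0 never arises for [i <= n], where the level is finite. *)
pose h i := if dell i.+1 (C i) is Some k then k else 0%N.
(* This [m] satisfies [n <= m] and [h i <= m - i] for all [i <= n]. *)
exists (n + \max_(i < n.+1) (h i + i))%N, n, C, d, e.
split=> // [|i ni]; first exact: leq_addr.
have := (deloopsP i.+1 (fgC i ni)).2 (FC i ni).2.
have : (h i + i <= \max_(i < n.+1) (h i + i))%N.
  have lt_in : (i < n.+1)%N by rewrite ltnS.
  exact: (leq_bigmax (F := fun k : 'I_n.+1 => (h k + k)%N) (Ordinal lt_in)).
move: (\max_(i < n.+1) (h i + i)) => b; rewrite /h.
case: dell => //= k le_b _; have le_i := leq_trans ni (leq_addr b n).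
by rewrite -(leq_add2r i) subnK //; apply: leq_trans le_b (leq_addl _ _).
Qed.

Lemma resolved_fin_gen j n M : resolved fg_deloops j n M -> fin_gen M.
Proof.
by case: n => [[]|n] //= [C [M' [f [g [[_ _ gs] [fgC _] _]]]]];
  apply: fin_gen_surj gs fgC.
Qed.

(** The horseshoe on [0 -> M' -> C -> M -> 0] gives [0 -> K' -> W -> K -> 0] with [K'] and [W]
    syzygies of [M'] and [C], so the index of every term goes up by one. *)
Lemma resolved_syz j n M K : resolved fg_deloops j n M -> syz M K ->
  resolved fg_deloops j.+1 n K.
Proof.
elim: n j M K => [|n IHn] j M K /=.
  move=> [fgM dM] sM; split; first exact: fin_gen_syz sM.
  exact: deloops_syz sM.
move=> [C [M' [f [g [fg [fgC dC] rM']]]]] [P [i [p [fgP pP ip]]]].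
have [Q [q [fgQ pQ qs]]] := ex_projective_onto (resolved_fin_gen rM').
have [K' [k [kI kq]]] := ex_kernel q.
have kqE : short_exact k q by split.
have [W [w [r [u [v [wr uv]]]]]] := ex_horseshoe fg kqE ip pP.
have sCW : syz C W.
  exists (Q * P)%type, w, r.
  by split=> //; [exact: fin_gen_prod | exact: projective_prod].
exists W, K', u, v; split=> //.
  by split; [exact: fin_gen_syz sCW | exact: deloops_syz sCW].
by apply: IHn rM' _; exists Q, k, q.
Qed.

(** The horseshoe kernel [Z] is an extension of a syzygy of [C] by [A']. Both ends are resolved from
    index [j.+1]: [A'] as the tail of the resolution of [A], the syzygy by [resolved_syz]. Hence
    induction applies to [Z]. *)
Lemma resolved_ext j n n' A B C (f : {linear A -> B}) (g : {linear B -> C}) :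
  short_exact f g -> resolved fg_deloops j n A -> resolved fg_deloops j n' C ->
  exists m, resolved fg_deloops j m B.
Proof.
elim: n j n' A B C f g => [|n IHn] j n' A B C f g fg /= rA rC;
  have [P [p [fgP pP ps]]] := ex_projective_onto (resolved_fin_gen rC);
  have [K [i [iI ip]]] := ex_kernel p;
  (have ipE : short_exact i p by split);
  (have sCK : syz C K by exists P, i, p);
  have rK := resolved_syz rC sCK.
  (* In length 0 the horseshoe is used with [A0 = A] and [A' = 0], so that [Z] is isomorphic to the
     syzygy of [C]. *)
  pose O : lmodType R := 'I_0 -> R^o.
  have O0 (x : O) : x = 0 by apply/funext=> -[].
  pose o : {linear O -> A} := \0.
  have oE : short_exact o (idfun : {linear A -> A}).
    split=> [x y _|y|y]; first by rewrite (O0 x) (O0 y).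
      by split=> [y0|[x <-]] //; exists 0; apply: esym.
    by exists y.
  have [Z [z [r [u [v [zr uv]]]]]] := ex_horseshoe fg oE ipE pP.
  exists n'.+1, (A * P)%type, Z, z, r; split=> //; last first.
    exact: resolved_iso fg_deloops_iso (short_exact_trivial_left uv O0) rK.
  have [fgA dA] := rA; have fgAP := fin_gen_prod fgA fgP; split=> //.
  exact: deloops_stable_retract (stable_retract_prod_projective A fgP pP) dA.
have [A0 [A' [k [q [kq [fgA0 dA0] rA']]]]] := rA.
have [Z [z [r [u [v [zr uv]]]]]] := ex_horseshoe fg kq ipE pP.
have [m rZ] := IHn _ _ _ _ _ _ _ uv rA' rK.
exists m.+1, (A0 * P)%type, Z, z, r; split=> //.
have fgAP := fin_gen_prod fgA0 fgP; split=> //.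
exact: deloops_stable_retract (stable_retract_prod_projective A0 fgP pP) dA0.
Qed.

(* Uses 0 -> Omega M -> Omega (M/N) -> N -> 0. *)
Lemma resolved_sub n N M (f : {linear N -> M}) : injective f ->
  resolved fg_deloops 1 n M -> resolved fg_deloops 1 n.+1 N.
Proof.
move=> fI rM; have fgM := resolved_fin_gen rM.
have [Q [q [fgQ pQ qs]]] := ex_projective_onto fgM.
have [K0 [k0 [k0I k0q]]] := ex_kernel q.
(* [W] is [M/N]; the kernels of [Q] onto [M] and of [Q] onto [W] are the syzygies [K0] and [K]. *)
have [|W [w [ws wE]]] := @ex_quotient R M (fun y => exists x, f x = y).
  split=> [|a _ _ [x <-] [y <-]]; first by exists 0; rewrite linear0.
  by exists (a *: x + y); rewrite linearP.
pose wq : {linear Q -> W} := w \o q.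
have wqs : surj wq.
  by move=> y; have [x <-] := ws y; have [t <-] := qs x; exists t.
have [K [k [kI kwq]]] := ex_kernel wq.
have sWK : syz W K by exists Q, k, wq.
have [|v vE] := linear_factor (h := q \o k : {linear K -> M}) fI.
  by move=> x; apply/wE/(kwq (k x)); exists x.
have [|u uE] := linear_factor (h := k0) kI.
  move=> x; apply/kwq; rewrite /= (_ : q _ = 0) ?linear0 //.
  by apply/k0q; exists x.
exists K, K0, u, v; split.
- split=> [x y /(congr1 k)|x|y].
  + by rewrite !uE => /k0I.
  + split=> [vx|[y <-]].
      have [|y yE] := (k0q (k x)).1; first by rewrite -[LHS]vE vx linear0.
      by exists y; apply: kI; rewrite uE.
    by apply: fI; rewrite vE /= uE linear0; apply/k0q; exists y.
  have [x xE] := qs (f y).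
  have [|t tE] := (kwq x).1; first by rewrite /= xE; apply/wE; exists y.
  by exists t; apply: fI; rewrite vE /= tE.
- split; first exact: fin_gen_syz sWK.
  exact: syz_deloops (fin_gen_surj ws fgM) sWK.
by apply: resolved_syz rM _; exists Q, k0, q.
Qed.

Lemma finite_ddell_ext A B C (f : {linear A -> B}) (g : {linear B -> C}) :
  short_exact f g -> finite_ddell A -> finite_ddell C -> finite_ddell B.
Proof.
move=> fg /finite_ddellP[n rA] /finite_ddellP[n' rC].
exact/finite_ddellP/(resolved_ext fg rA rC).
Qed.

Lemma finite_ddell_sub N M (f : {linear N -> M}) :
  injective f -> finite_ddell M -> finite_ddell N.
Proof.
move=> fI /finite_ddellP[n rM]; apply/finite_ddellP; exists n.+1.
exact: (resolved_sub fI rM).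
Qed.

(** The zero module is a syzygy of itself, so it deloops once. This covers the empty direct sum. *)
Lemma finite_ddell_trivial M : (forall x : M, x = 0) -> finite_ddell M.
Proof.
move=> M0; have pM := projective_trivial M0.
have fgM : fin_gen M.
  by exists 0%N, (fun=> 0) => x; exists (fun=> 0); rewrite big_ord0.
apply/finite_ddellP; exists 0%N; split=> //.
apply: (@syz_deloops M) => //; exists M, idfun, (\0 : {linear M -> M}).
split=> //; split=> // y; first by split=> // _; exists y.
by exists 0; rewrite (M0 y).
Qed.

(** As the class is closed under submodules, a direct sum need only embed in a member [T] of it;
    jointly injective coordinates on [S] yield such an embedding. *)
Lemma finite_ddell_product n (A : 'I_n -> lmodType R) :
  (forall i, finite_ddell (A i)) ->
  exists T, finite_ddell T /\
    forall S (h : forall i, {linear S -> A i}),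
      exists f : {linear S -> T}, forall x, f x = 0 -> forall i, h i x = 0.
Proof.
elim: n A => [|n IHn] A FA.
  exists ('I_0 -> R^o); split.
    by apply: finite_ddell_trivial => x; apply/funext => -[].
  by move=> S h; exists \0 => x _ [].
have [T [FT univ]] := IHn (fun i => A (lift ord0 i)) (fun i => FA _).
exists (A ord0 * T)%type; split.
  exact: finite_ddell_ext (short_exact_prod _ _) (FA ord0) FT.
move=> S h; have [f fE] := univ S (fun i => h (lift ord0 i)).
exists (linear_pair (h ord0) f) => x [h0 /fE fx] i.
by have [j ->|->] := unliftP ord0 i.
Qed.

Lemma finite_ddell_torsion_free : torsion_free_class (@finite_ddell R).
Proof.
split=> [M []//|A B C f g|N M f|n A S iota dS FA].
- exact: finite_ddell_ext.
- exact: finite_ddell_sub.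
have [T [FT univ]] := finite_ddell_product FA.
have [a aE] := choice dS.
(* Uniqueness of components makes the coordinates of a direct sum linear. *)
have lin_a i : linear (fun s => a s i).
  move=> c x y; have [_ aU] := aE (c *: x + y).
  rewrite -(aU (fun i => c *: a x i + a y i)) //.
  rewrite {1}(aE x).1 {1}(aE y).1 scaler_sumr -big_split.
  by apply: eq_bigr => k _; rewrite linearP.
have [f fE] := univ S (fun i => mklin (lin_a i)).
apply: (finite_ddell_sub (f := f)) FT; apply: linear_inj0 => x /fE ax0.
rewrite (aE x).1 big1 // => i _.
by rewrite -[a x i]/(mklin (lin_a i) x) ax0 linear0.
Qed.

End DerivedDelooping.

(** * Complements and generator counts in vector spaces *)

Section VectorSpaces.
Variable K : fieldType.
Implicit Types U V W : lmodType K.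

(** Zorn's lemma gives a maximal [C] closed under linear combinations and meeting the image of [i]
    at most in 0. It is a complement of the image, and [r] is the projection along it. *)
Lemma linear_retraction U V (i : {linear U -> V}) : injective i ->
  exists r : {linear V -> U}, cancel i r.
Proof.
move=> iI.
pose lc (C : set V) := forall a b x y, C x -> C y -> C (a *: x + b *: y).
pose P (C : set V) := lc C /\ forall u, C (i u) -> i u = 0.
have [F FP Ftot|C [[Clc CU] Cmax]] := @Zorn_bigcup V P.
  split=> [a b x y [A FA Ax] [B FB By]|u [A FA Au]].
    have [AB|BA] := Ftot A B FA FB.
      by exists B => //; apply: (FP B FB).1 => //; apply: AB.
    by exists A => //; apply: (FP A FA).1 => //; apply: BA.
  exact: (FP A FA).2.
(* The union of an empty chain is empty, so [P] does not ask for 0 in [C]; [C0] adjoins it. *)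
pose C0 x := x = 0 \/ C x.
have C0lc a b x y : C0 x -> C0 y -> C0 (a *: x + b *: y).
  move=> [->|Cx] [->|Cy]; rewrite ?scaler0 ?addr0 ?add0r; first by left.
  - by right; have := Clc 0 b y y Cy Cy; rewrite scale0r add0r.
  - by right; have := Clc a 0 x x Cx Cx; rewrite scale0r addr0.
  by right; apply: Clc.
have C0U u : C0 (i u) -> u = 0.
  by move=> h; apply: iI; rewrite linear0; case: h => // /CU.
have split_V v : exists u, C0 (v - i u).
  apply: contrapT => nv.
  (* If no [v - i u] lies in [C0], then [C0] and [v] together span a set that still meets the image
     trivially, against maximality. *)
  pose C' : set V := fun x => exists c k, C0 c /\ x = c + k *: v.
  have C'v : C' v by exists 0, 1; rewrite add0r scale1r; split=> //; left.
  apply: (Cmax C').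
    split=> [x Cx|].
      by exists x, 0; rewrite scale0r addr0; split=> //; right.
    by move=> /(_ v C'v) Cv; apply: nv; exists 0; rewrite linear0 subr0; right.
  split=> [a b _ _ [c [k [Cc ->]]] [d [l [Cd ->]]]|u [c [k [Cc ue]]]].
    exists (a *: c + b *: d), (a * k + b * l); split; first exact: C0lc.
    by rewrite !scalerDr scalerDl !scalerA addrACA.
  have [k0|k0] := eqVneq k 0.
    by move: ue; rewrite k0 scale0r addr0 => uc; rewrite (C0U u) ?linear0 ?uc.
  case: nv; exists (k^-1 *: u).
  have -> : v - i (k^-1 *: u) = (- k^-1) *: c + 0 *: c.
    rewrite linearZ /= ue scalerDr scalerA mulVf // scale1r opprD addrCA subrr.
    by rewrite addr0 scaleNr scale0r addr0.
  exact: C0lc.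
have [r rE] := choice split_V.
have rU v u : C0 (v - i u) -> r v = u.
  move=> h; apply/eqP; rewrite -subr_eq0; apply/eqP/C0U.
  have := C0lc 1 (-1) _ _ h (rE v).
  by rewrite scale1r scaleN1r opprB addrC addrA subrK linearB.
have lr : linear r.
  move=> a x y; apply: rU; have := C0lc a 1 _ _ (rE x) (rE y).
  by rewrite scale1r scalerBr addrACA linearP opprD.
by exists (mklin lr) => u; apply: rU; left; rewrite subrr.
Qed.

Definition spanned n V : Prop :=
  exists g : 'I_n -> V, forall x, exists c : 'I_n -> K, x = \sum_i c i *: g i.

Lemma spanned_drop n V W (f : {linear V -> W}) v :
  surj f -> f v = 0 -> v != 0 -> spanned n V ->
  exists2 m, (m < n)%N & spanned m W.
Proof.
move=> fs fv v0 [g gE]; have [c cE] := gE v.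
have [i0 ci0] : exists i, c i != 0.
  apply: contrapT => nc; case/eqP: v0; rewrite cE big1 // => i _.
  have [->|ci] := eqVneq (c i) 0; first by rewrite scale0r.
  by case: nc; exists i.
case: n g gE c cE i0 ci0 => [g gE c cE []//|n g gE c cE i0 ci0].
exists n => //; exists (fun j => f (g (lift i0 j))) => y.
have [x <-] := fs y; have [d dE] := gE x.
exists (fun j => d (lift i0 j) - d i0 / c i0 * c (lift i0 j)).
have -> : f x = f (x - (d i0 / c i0) *: v).
  by rewrite linearB linearZ /= fv scaler0 subr0.
rewrite {1}dE {1}cE scaler_sumr -sumrB linear_sum (bigD1_ord i0) //=.
rewrite scalerA divfK // subrr linear0 add0r; apply: eq_bigr => j _.
by rewrite scalerA -scalerBl linearZ.
Qed.
End VectorSpaces.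

(** * Restriction of scalars *)

Definition res_scalars (K R : pzRingType) (c : {rmorphism K -> R})
  (M : lmodType R) : Type := M.

Section RestrictionOfScalars.
Variables (K R : pzRingType) (c : {rmorphism K -> R}) (M : lmodType R).
HB.instance Definition _ := GRing.Zmodule.on (res_scalars c M).

Definition res_scale (k : K) (x : res_scalars c M) : res_scalars c M :=
  c k *: (x : M).

Lemma res_scaleA a b v :
  res_scale a (res_scale b v) = res_scale (a * b) v.
Proof. by rewrite /res_scale scalerA rmorphM. Qed.

Lemma res_scale1 : left_id 1 res_scale.
Proof. by move=> v; rewrite /res_scale rmorph1 scale1r. Qed.

Lemma res_scaleDr : right_distributive res_scale +%R.
Proof. by move=> a u v; rewrite /res_scale scalerDr. Qed.

Lemma res_scaleDl v : {morph res_scale^~ v : a b / a + b}.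
Proof. by move=> a b; rewrite /res_scale rmorphD scalerDl. Qed.

HB.instance Definition _ := GRing.Zmodule_isLmodule.Build K (res_scalars c M)
  res_scaleA res_scale1 res_scaleDr res_scaleDl.
End RestrictionOfScalars.

(** * Noetherianity and projective covers in the finite dimensional case *)

Section FiniteDimensional.
Variables (K : fieldType) (R : pzRingType) (c : {rmorphism K -> R}).
Implicit Types A B C M N P Q : lmodType R.

Lemma res_linear_proof M N (f : {linear M -> N}) :
  linear (f : res_scalars c M -> res_scalars c N).
Proof. by move=> a x y; rewrite [LHS](linearP f (c a)). Qed.

Definition res_linear M N (f : {linear M -> N}) :
  {linear res_scalars c M -> res_scalars c N} := mklin (res_linear_proof f).

Lemma fin_gen_finType (S : pzRingType) (M : lmodType S) (I : finType)
    (g : I -> M) :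
  (forall x, exists k : I -> S, x = \sum_i k i *: g i) -> fin_gen M.
Proof.
move=> gE; exists #|I|, (fun i => g (enum_val i)) => x.
have [k ->] := gE x; exists (fun i => k (enum_val i)).
by rewrite (reindex_onto enum_val enum_rank) /= => [|i _];
  rewrite ?enum_rankK //; apply: eq_bigl => i; rewrite enum_valK eqxx.
Qed.

Lemma res_fin_gen M : fin_gen (res_scalars c M) -> fin_gen M.
Proof.
move=> [n [g gE]]; exists n, g => x.
by have [k kE] := gE x; exists (fun i => c (k i)).
Qed.

Hypothesis fdR : fin_gen (res_scalars c R^o).

Lemma fin_gen_res M : fin_gen M -> fin_gen (res_scalars c M).
Proof.
move=> [n [g gE]]; have [m [e eE]] := fdR.
apply: (@fin_gen_finType _ (res_scalars c M) ('I_n * 'I_m)%type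
          (fun ij => (e ij.2 : R) *: g ij.1)) => x.
have [r rE] := gE x.
have [k kE] := choice (fun i => eE (r i)).
exists (fun ij => k ij.1 ij.2).
rewrite -(pair_bigA _
  (fun i j => k i j *: ((e j : R) *: g i : res_scalars c M))).
rewrite [LHS]rE; apply: eq_bigr => i _ /=.
rewrite {1}kE scaler_suml; apply: eq_bigr => j _.
by rewrite -scalerA.
Qed.

(** A [K]-linear retraction of [f] exhibits [N] as a quotient of the finite dimensional space
    [M]. *)
Lemma fin_gen_sub N M (f : {linear N -> M}) :
  injective f -> fin_gen M -> fin_gen N.
Proof.
move=> fI fgM; apply: res_fin_gen.
have [r rK] := linear_retraction (i := res_linear f) fI.
apply: (fin_gen_surj (f := r)) (fin_gen_res fgM) => y.
by exists (f y); rewrite [LHS]rK.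
Qed.

(* Among the submodules of P that still map onto M, one of least dimension is
   a direct summand of P, and its map to M is a projective cover. *)
Lemma ex_projective_cover M : fin_gen M ->
  exists P (p : {linear P -> M}), fin_gen P /\ projective_cover p.
Proof.
move=> fgM; have [P [p [fgP pP ps]]] := ex_projective_onto fgM.
pose S n := exists Q (i : {linear Q -> P}),
  [/\ injective i, surj (p \o i) & spanned n (res_scalars c Q)].
have exS : exists n, `[< S n >].
  have [n sn] := fin_gen_res fgP; exists n; apply/asboolP.
  by exists P, (idfun : {linear P -> P}).
case: (ex_minnP exS) => n /asboolP[Q [i [iI pis sQ]]] nmin.
have Qmin m (U : lmodType R) (j : {linear U -> P}) :
    injective j -> surj (p \o j) -> spanned m (res_scalars c U) -> (n <= m)%N.
  by move=> jI pjs sU; apply/nmin/asboolP; exists U, j.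
(* A [K]-linear retraction onto a proper [U] has nonzero kernel, so [U] is spanned by fewer than [n]
   vectors, against the choice of [n]. *)
have sub_full (U : lmodType R) (j : {linear U -> Q}) :
    injective j -> surj (p \o (i \o j)) -> surj j.
  move=> jI pijs x; apply: contrapT => nx.
  have [r rK] := linear_retraction (i := res_linear j) jI.
  have rs : surj r by move=> u; exists (j u); rewrite [LHS]rK.
  have rv : r ((x : res_scalars c Q) - res_linear j (r x)) = 0.
    by rewrite linearB /= [r (j _)]rK subrr.
  have [|m lt_mn sU] := spanned_drop rs rv _ sQ.
    by apply/eqP => /eqP; rewrite subr_eq0 => /eqP xE; apply: nx; exists (r x).
  have := Qmin m U (i \o j : {linear U -> P}) (inj_comp iI jI) pijs sU.
  by rewrite leqNgt lt_mn.
(* Since [p i h = p], the image of [h i] still maps onto [M], so [h i] is surjective; minimality of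
   [n] makes it injective. Thus [Q] is a retract of [P]. *)
have [h hE] := pP Q M (p \o i : {linear Q -> M}) p pis.
pose hi : {linear Q -> Q} := h \o i.
have his : surj hi.
  have [U [u [j [us jI juE]]]] := ex_image hi.
  have js : surj j.
    apply: sub_full jI _ => y; have [x <-] := pis y; exists (u x).
    by rewrite /= juE; apply: hE.
  by move=> y; have [z <-] := js y; have [x <-] := us z; exists x; rewrite juE.
have hiI : injective hi.
  apply: linear_inj0 => v hiv; apply/eqP; apply: contraT => v0.
  have [m lt_mn sQ'] := spanned_drop (f := res_linear hi) his hiv v0 sQ.
  by have := Qmin m Q i iI pis sQ'; rewrite leqNgt lt_mn.
have [w [wK _]] := linear_inverse hiI his.
have pQ : projective Q.
  by apply: (projective_retract (f := i) (g := w \o h)) pP; exact: wK.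
exists Q, (p \o i : {linear Q -> M}); split; first exact: fin_gen_sub iI fgP.
split=> // U [U0 Ucl] Uker x.
have [|V [j [jI jE]]] := @ex_submodule R Q (fun x => x \in U).
  by split=> // a y z; apply: Ucl.
apply/(jE x); apply: sub_full => // y; have [z <-] := pis y.
have [u [k [Uu pk ->]]] := Uker z; have [v vE] := (jE u).1 Uu.
by exists v; rewrite linearD pk addr0 /= vE.
Qed.
End FiniteDimensional.

(* A and B are anti-isomorphic K-algebras, so that Hom_K(-, K) turns B-modules
   into A-modules. *)
Record dual_pair (K : fieldType) (A B : pzRingType) := DualPair {
  dp_anti : A -> B;
  dp_scal : {rmorphism K -> B};
  dp_antiD : {morph dp_anti : a b / a + b};
  dp_anti1 : dp_anti 1 = 1;
  dp_antiM : forall a b, dp_anti (a * b) = dp_anti b * dp_anti a;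
  dp_central : forall k b, dp_scal k * b = b * dp_scal k
}.

(** * The dual of a module over the ground field *)

Section Dual.
Variables (K : fieldType) (A B : pzRingType) (d : dual_pair K A B).
Variable M : lmodType B.

Definition functional : (res_scalars (dp_scal d) M -> K^o) -> bool :=
  fun f => `[< linear f >].

Lemma functional_closed : zmod_closed functional.
Proof.
split=> [|f g /asboolP lf /asboolP lg].
  by apply/asboolP => a x y; rewrite scaler0 addr0.
apply/asboolP => a x y; rewrite -[LHS]/(f _ - g _) lf lg.
by rewrite opprD addrACA -scalerBr.
Qed.

HB.instance Definition _ := GRing.isZmodClosed.Build _ functional
  functional_closed.

Record dual := Dual {
  dual_fun :> res_scalars (dp_scal d) M -> K^o;
  dual_funP : dual_fun \in functional
}.

HB.instance Definition _ := [isSub for dual_fun].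
HB.instance Definition _ := [Choice of dual by <:].
HB.instance Definition _ := [SubChoice_isSubZmodule of dual by <:].

Lemma dual_ext (f g : dual) : (forall x, f x = g x) -> f = g.
Proof. by move=> fg; apply/val_inj/funext. Qed.

Lemma dual_addE (f g : dual) x : (f + g) x = f x + g x.
Proof. by []. Qed.

Lemma dual_linear (f : dual) : linear f.
Proof. exact/asboolP/(dual_funP f). Qed.

Definition dual_lin (f : dual) : {linear res_scalars (dp_scal d) M -> K^o} :=
  mklin (dual_linear f).

Lemma dual_funD (f : dual) (x y : M) : f (x + y) = f x + f y.
Proof. exact: (linearD (dual_lin f)). Qed.

Lemma dual_funZ (f : dual) k (x : M) : f (dp_scal d k *: x) = k * f x.
Proof. exact: (linearZ_LR (dual_lin f)). Qed.

Lemma ex_dual (f : M -> K) : {morph f : x y / x + y} ->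
  (forall k x, f (dp_scal d k *: x) = k * f x) ->
  exists g : dual, forall x, g x = f x.
Proof.
move=> fD fZ; have fP : (f : res_scalars (dp_scal d) M -> K^o) \in functional.
  by apply/asboolP => a x y; rewrite [LHS]fD [X in X + _]fZ.
by exists (Dual fP).
Qed.

Lemma dual_scale_proof (a : A) (f : dual) :
  (fun x : res_scalars (dp_scal d) M => f (dp_anti d a *: (x : M)))
    \in functional.
Proof.
apply/asboolP => k x y; rewrite -[_ *: x + y]/(dp_scal d k *: (x : M) + y).
by rewrite scalerDr scalerA -dp_central -scalerA dual_funD dual_funZ.
Qed.

Definition dual_scale a f : dual := Dual (dual_scale_proof a f).

Lemma dual_scaleA a b v : dual_scale a (dual_scale b v) = dual_scale (a * b) v.
Proof. by apply: dual_ext => x /=; rewrite scalerA dp_antiM. Qed.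

Lemma dual_scale1 : left_id 1 dual_scale.
Proof. by move=> f; apply: dual_ext => x /=; rewrite dp_anti1 scale1r. Qed.

Lemma dual_scaleDr : right_distributive dual_scale +%R.
Proof. by move=> a f g; apply: dual_ext. Qed.

Lemma dual_scaleDl f : {morph dual_scale^~ f : a b / a + b}.
Proof.
move=> a b; apply: dual_ext => x.
by rewrite dual_addE /= dp_antiD scalerDl dual_funD.
Qed.

HB.instance Definition _ := GRing.Zmodule_isLmodule.Build A dual
  dual_scaleA dual_scale1 dual_scaleDr dual_scaleDl.

Lemma dual_scaleE a (f : dual) (x : M) : (a *: f) x = f (dp_anti d a *: x).
Proof. by []. Qed.

End Dual.

(** * Exactness of the duality *)

Section DualMaps.
Variables (K : fieldType) (A B : pzRingType) (d : dual_pair K A B).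
Implicit Types M N P Q : lmodType B.

Lemma dual_map_proof M N (h : {linear M -> N}) (f : dual d N) :
  (fun x : res_scalars (dp_scal d) M => f (h x)) \in @functional K A B d M.
Proof.
apply/asboolP => k x y; rewrite -[_ *: x + y]/(dp_scal d k *: (x : M) + y).
by rewrite linearP dual_funD dual_funZ.
Qed.

Definition dual_map_fun M N (h : {linear M -> N}) (f : dual d N) : dual d M :=
  Dual (dual_map_proof h f).

Lemma dual_map_linear M N (h : {linear M -> N}) : linear (dual_map_fun h).
Proof.
move=> a f g; apply: dual_ext => x.
by rewrite !dual_addE !dual_scaleE /= linearZ.
Qed.

Definition dual_map M N (h : {linear M -> N}) : {linear dual d N -> dual d M} :=
  mklin (dual_map_linear h).

Lemma dual_mapE M N (h : {linear M -> N}) (f : dual d N) x :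
  dual_map h f x = f (h x).
Proof. by []. Qed.

Lemma dual_map_surj M N (h : {linear M -> N}) :
  injective h -> surj (dual_map h).
Proof.
move=> hI f; have [r rK] := linear_retraction
  (i := res_linear (dp_scal d) h) hI.
have [||g gE] := @ex_dual K A B d N (fun x => f (r x)).
- by move=> x y; rewrite [r _]linearD dual_funD.
- move=> k x; rewrite -[_ *: x]/(k *: (x : res_scalars (dp_scal d) N)).
  by rewrite linearZ /= -[_ *: r x]/(dp_scal d k *: (r x : M)) dual_funZ.
exists g; apply: dual_ext => x; rewrite dual_mapE gE.
by congr (f _); exact: rK.
Qed.

Lemma dual_short_exact M N P (f : {linear M -> N}) (g : {linear N -> P}) :
  short_exact f g -> short_exact (dual_map g) (dual_map f).
Proof.
move=> [fI fg gs]; split; last exact: dual_map_surj.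
  move=> u v /(congr1 (@dual_fun _ _ _ _ _)) e; apply: dual_ext => y.
  by have [x <-] := gs y; have := congr1 (@^~ x) e.
move=> u; split=> [fu|[v <-]]; last first.
  apply: dual_ext => x; rewrite !dual_mapE (_ : g (f x) = 0).
    exact: (linear0 (dual_lin v)).
  by apply/fg; exists x.
have [s sE] := choice gs.
(* A functional vanishing on the image of [f] is constant on the fibres of [g], so its composite
   with any section of [g] is linear. *)
have u_ker y z : g y = g z -> u y = u z.
  move=> e; have [|x xE] := (fg (y - z)).1.
    by rewrite linearB /= e subrr.
  rewrite -[y](subrK z) dual_funD -xE.
  by have := congr1 (fun w : dual d M => w x) fu;
    rewrite dual_mapE => ->; rewrite add0r.
have [||v vE] := @ex_dual K A B d P (fun y => u (s y)).
- move=> x y; rewrite -dual_funD; apply: u_ker.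
  by rewrite linearD !sE.
- move=> k x; rewrite -dual_funZ; apply: u_ker.
  by rewrite linearZ /= !sE.
by exists v; apply: dual_ext => x; rewrite dual_mapE vE; apply/u_ker/sE.
Qed.

End DualMaps.

(** * Injectivity of duals of projective modules *)

Section DualInjective.
Variables (K : fieldType) (A B : pzRingType).
Variables (d : dual_pair K A B) (d' : dual_pair K B A).
Hypotheses (antiK : cancel (dp_anti d) (dp_anti d'))
  (antiK' : cancel (dp_anti d') (dp_anti d))
  (scalE : forall k, dp_anti d (dp_scal d' k) = dp_scal d k).

(* Transposition turns maps X -> D P into maps P -> D' X, so the dual of a
   projective module is injective. *)
Lemma dual_injective (P : lmodType B) (X Y : lmodType A)
    (j : {linear X -> Y}) (f : {linear X -> dual d P}) :
  projective P -> injective j ->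
  exists g : {linear Y -> dual d P}, forall x, g (j x) = f x.
Proof.
move=> pP jI.
have [ft ftE] : exists ft : {linear P -> dual d' X},
    forall (p : P) (x : X), ft p x = f x p.
  have ex (p : P) : exists u : dual d' X, forall x : X, u x = f x p.
    apply: ex_dual => [x y|k x]; first by rewrite linearD.
    by rewrite linearZ_LR dual_scaleE scalE dual_funZ.
  have [u uE] := choice ex.
  have lu : linear u.
    move=> b p q; apply: dual_ext => x.
    rewrite dual_addE dual_scaleE !uE dual_funD linearZ_LR.
    by rewrite dual_scaleE antiK'.
  by exists (mklin lu).
(* The transposed map [ft] lifts through the surjection dual to [j]; transposing the lift back gives
   the extension. *)
have [h hE] := pP _ _ (dual_map d' j) ft (dual_map_surj jI).
have ex (y : Y) : exists v : dual d P, forall p : P, v p = h p y.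
  apply: ex_dual => [p q|k p]; first by rewrite linearD.
  by rewrite linearZ_LR dual_scaleE -scalE antiK dual_funZ.
have [v vE] := choice ex.
have lv : linear v.
  move=> a y z; apply: dual_ext => p.
  by rewrite dual_addE dual_scaleE !vE dual_funD linearZ_LR dual_scaleE antiK.
exists (mklin lv) => x; apply: dual_ext => p.
by rewrite [LHS]vE -ftE -hE.
Qed.

End DualInjective.

(** * Vanishing of Ext and long exact sequences *)

Section ExtVanishing.
Variables (R : pzRingType) (P : nat -> lmodType R).
Variable d : forall i, {linear P i.+1 -> P i}.
Hypotheses (projP : forall i, projective (P i))
  (exd : forall i, exact_at (d i.+1) (d i)).
Implicit Types I W Y Z : lmodType R.

Let dd i x : d i (d i.+1 x) = 0.
Proof. by apply/exd; exists x. Qed.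

(* If P resolves X, this says Ext^(k+1)(X, Z) = 0. *)
Definition ext_vanish k Z : Prop :=
  forall f : {linear P k.+1 -> Z}, (forall x, f (d k.+1 x) = 0) ->
    exists g : {linear P k -> Z}, forall x, g (d k x) = f x.

(** Exactness of Ext^(k+1)(X, W) -> Ext^(k+2)(X, Z) -> Ext^(k+2)(X, Y), chased on cocycles. *)
Lemma ext_vanish_left k Z Y W (u : {linear Z -> Y}) (v : {linear Y -> W}) :
  short_exact u v -> ext_vanish k W -> ext_vanish k.+1 Y -> ext_vanish k.+1 Z.
Proof.
move=> [uI uv vs] VW VY f fd.
have vu z : v (u z) = 0 by apply/uv; exists z.
have [|g gE] := VY (u \o f : {linear _ -> _}).
  by move=> x; rewrite /= fd linear0.
have [|h hE] := VW (v \o g : {linear _ -> _}).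
  by move=> x; rewrite /= gE /= vu.
have [h' h'E] := projP h vs.
have [|g' g'E] := linear_factor
    (h := g \- (h' \o d k) : {linear P k.+1 -> Y}) uI.
  by move=> x; apply/uv; rewrite linearB /= h'E hE subrr.
by exists g' => x; apply: uI; rewrite g'E /= gE dd linear0 subr0.
Qed.

(** Exactness of Ext^(k+1)(X, I) -> Ext^(k+1)(X, W) -> Ext^(k+2)(X, Z). *)
Lemma ext_vanish_right k Z I W (u : {linear Z -> I}) (v : {linear I -> W}) :
  short_exact u v -> ext_vanish k I -> ext_vanish k.+1 Z -> ext_vanish k W.
Proof.
move=> [uI uv vs] VI VZ f fd.
have vu z : v (u z) = 0 by apply/uv; exists z.
have [f' f'E] := projP f vs.
have [|f2 f2E] := linear_factor
    (h := f' \o d k.+1 : {linear P k.+2 -> I}) uI.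
  by move=> x; apply/uv; rewrite f'E fd.
have [|g gE] := VZ f2.
  by move=> x; apply: uI; rewrite f2E /= dd !linear0.
have [|h hE] := VI (f' \- (u \o g) : {linear P k.+1 -> I}).
  by move=> x; rewrite /= gE f2E /= subrr.
exists (v \o h : {linear P k -> W}) => x.
by rewrite /= hE linearB /= vu subr0 f'E.
Qed.

(** A cocycle vanishes on the kernel of [d k], so it descends to the image of [d k] and extends from
    there to [P k]. *)
Lemma ext_vanish_injective k I :
  (forall (X Y : lmodType R) (j : {linear X -> Y}) (f : {linear X -> I}),
    injective j ->
    exists g : {linear Y -> I}, forall x, g (j x) = f x) -> ext_vanish k I.
Proof.
move=> injI f fd; have [C [g [i [gs iI giE]]]] := ex_image (d k).
have [|f' f'E] := linear_descend (h := f) gs.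
  by move=> x gx; have [|y <-] := (exd x).1; rewrite ?fd // -giE gx linear0.
by have [h hE] := injI _ _ i f' iI; exists h => x; rewrite -giE hE f'E.
Qed.

Lemma ext_vanish_trivial k Z : (forall x : P k.+1, x = 0) -> ext_vanish k Z.
Proof.
by move=> P0 f _; exists (\0 : {linear P k -> Z}) => x; rewrite (P0 x) !linear0.
Qed.

End ExtVanishing.

(** * Ext into duals of modules of finite derived delooping level *)

Section DualExtVanishing.
Variables (K : fieldType) (A B : pzRingType).
Variables (d : dual_pair K A B) (d' : dual_pair K B A).
Hypotheses (antiK : cancel (dp_anti d) (dp_anti d'))
  (antiK' : cancel (dp_anti d') (dp_anti d))
  (scalE : forall k, dp_anti d (dp_scal d' k) = dp_scal d k).
Implicit Types C M N Q X Y S : lmodType B.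

Definition projective_complex (P : nat -> lmodType A)
    (dP : forall i, {linear P i.+1 -> P i}) : Prop :=
  (forall i, projective (P i)) /\ forall i, exact_at (dP i.+1) (dP i).

Section FixedComplex.
Variables (P : nat -> lmodType A) (dP : forall i, {linear P i.+1 -> P i}).
Hypothesis cP : projective_complex dP.
Let projP := cP.1.
Let exP := cP.2.

Local Notation V k M := (ext_vanish dP k (dual d M)).

Lemma ext_vanish_dual_projective k Q : projective Q -> V k Q.
Proof.
move=> pQ; apply: ext_vanish_injective => // X Y j f jI.
exact: (dual_injective antiK antiK' scalE f pQ jI).
Qed.

Lemma ext_vanish_stable_retract k X Y : stable_retract X Y -> V k Y -> V k X.
Proof.
move=> [f [g [Q [a [b [_ pQ e]]]]]] VY h hd.
have [|u uE] := VY (dual_map d g \o h : {linear _ -> _}).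
  by move=> x; rewrite -[LHS]/(dual_map d g (h _)) hd linear0.
have [|v vE] := ext_vanish_dual_projective pQ (f := dual_map d b \o h).
  by move=> x; rewrite -[LHS]/(dual_map d b (h _)) hd linear0.
exists ((dual_map d f \o u) \+ (dual_map d a \o v) : {linear _ -> _}) => x.
rewrite /= uE vE; apply: dual_ext => y.
by rewrite dual_addE !dual_mapE /= -dual_funD e.
Qed.

(** Dualising [0 -> S -> Q -> M -> 0] gives an injective middle term, so Ext into [D S] shifts to
    Ext into [D M] one degree higher. *)
Lemma ext_vanish_syz k M S : syz M S -> V k S <-> V k.+1 M.
Proof.
move=> [Q [i [p [_ pQ /(dual_short_exact d) ip]]]].
split=> [VS|VM].
  apply: (ext_vanish_left projP exP ip VS).
  exact: ext_vanish_dual_projective.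
apply: (ext_vanish_right projP exP ip _ VM).
exact: ext_vanish_dual_projective.
Qed.

Lemma ext_vanish_nsyz k n M X : nsyz n M X -> V k X <-> V (k + n)%N M.
Proof.
elim: n M => [|n IHn] M /=.
  move=> /isomorphic_stable_retract[rMX rXM]; rewrite addn0.
  by split; apply: ext_vanish_stable_retract.
by move=> [L [sML /IHn ->]]; rewrite addnS; exact: ext_vanish_syz.
Qed.

End FixedComplex.

(** For a term [C] that deloops, shifting by [m] and by [m + j] reduces Ext^(k+1) into [D C] to
    Ext^(k+j+1) into [D N], which is zero because the complex ends in degree [k + j]. Resolutions
    follow from the long exact sequence of [0 -> D M -> D C -> D M' -> 0]. *)
Lemma resolved_ext_vanish j n M : resolved (@fg_deloops B) j n M ->
  exists b, forall (P : nat -> lmodType A)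
      (dP : forall i, {linear P i.+1 -> P i}),
    projective_complex dP -> forall k, (b <= k)%N ->
    (forall i, (k + j < i)%N -> forall x : P i, x = 0) ->
    ext_vanish dP k (dual d M).
Proof.
have deloops_vanish i C : deloops i C -> exists b,
    forall (P : nat -> lmodType A) (dP : forall i, {linear P i.+1 -> P i}),
    projective_complex dP -> forall k, (b <= k)%N ->
    (forall l, (k + i < l)%N -> forall x : P l, x = 0) ->
    ext_vanish dP k (dual d C).
  move=> [m [N [X [Y [_ nX nY rXY]]]]]; exists m => P dP cP k mk P0.
  rewrite -(subnK mk); apply/(ext_vanish_nsyz cP _ nX).
  apply: (ext_vanish_stable_retract cP rXY).
  apply/(ext_vanish_nsyz cP _ nY); rewrite addnA subnK //.
  exact/ext_vanish_trivial/P0.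
elim: n j M => [|n IHn] j M /=; first by case=> _ /deloops_vanish.
move=> [C [M' [f [g [/(dual_short_exact d) fg [_ dC] /IHn[b' Vb']]]]]].
(* [M'] is used one degree lower with index [j.+1], so the length bound is unchanged and its
   threshold enters as [b'.+1]. *)
have [b Vb] := deloops_vanish _ _ dC; exists (maxn b b'.+1) => P dP cP.
case=> [|k]; rewrite geq_max => /andP[bk b'k] // P0.
have [projP exP] := cP.
apply: (ext_vanish_left projP exP fg); last exact: Vb.
by apply: Vb' => // i; rewrite addnS -addSn; apply: P0.
Qed.

End DualExtVanishing.

(** The coordinate functions are linearly independent, so sending each to its point is linear on
    their span. The graph [W] encodes this map, and a linear retraction extends it to all
    functions. *)
Lemma ex_point_functional (K : fieldType) (V : lmodType K) :
  exists s : {linear (V -> K^o) -> V}, forall v, s (unit_fun K v) = v.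
Proof.
pose comb (l : seq (K * V)) : ((V -> K^o) * V)%type :=
  (\sum_(z <- l) z.1 *: unit_fun K z.2, \sum_(z <- l) z.1 *: z.2).
have [|W [i [iI iE]]] := @ex_submodule K ((V -> K^o) * V)%type
    (fun fx => exists l, fx = comb l).
  split=> [|a _ _ [l ->] [m ->]]; first by exists [::]; rewrite /comb !big_nil.
  exists ([seq (a * z.1, z.2) | z <- l] ++ m).
  rewrite -[LHS]/(a *: (comb l).1 + (comb m).1, a *: (comb l).2 + (comb m).2).
  rewrite /comb !big_cat !big_map /= !scaler_sumr.
  by congr (_ + _, _ + _); apply: eq_bigr => z _; rewrite scalerA.
(* The graph is single-valued: regrouped by distinct vectors, the second component has the values of
   the first as coefficients. *)
have comb0 l : (comb l).1 = 0 -> (comb l).2 = 0.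
  move=> l0; pose S := undup (map snd l).
  transitivity (\sum_(v <- S) (comb l).1 v *: v); last first.
    by rewrite l0 big1 // => v _; rewrite scale0r.
  rewrite /comb /= fct_sumE.
  under [RHS]eq_bigr => v _ do rewrite scaler_suml.
  rewrite exchange_big /= big_seq [RHS]big_seq; apply: eq_bigr => z zl.
  have zS : z.2 \in S by rewrite mem_undup map_f.
  rewrite (bigD1_seq z.2) ?undup_uniq //= big1 => [|v /negPf vz].
    by rewrite scale_unit_funE eqxx mulr1 addr0.
  by rewrite scale_unit_funE eq_sym vz mulr0 scale0r.
pose p : {linear W -> (V -> K^o)} := lin_fst _ _ \o i.
have pI : injective p.
  apply: linear_inj0 => w pw; apply: iI; rewrite linear0.
  have [l lE] := (iE (i w)).2 (ex_intro _ w erefl).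
  have c1 : (comb l).1 = 0 by rewrite -lE.
  by rewrite lE [LHS]surjective_pairing comb0 // c1.
have [r rK] := linear_retraction pI.
exists (lin_snd _ _ \o (i \o r)) => v.
have [|w wE] := (iE (unit_fun K v, v)).1.
  by exists [:: (1, v)]; rewrite /comb !big_seq1 !scale1r.
by have -> : unit_fun K v = p w; rewrite /= ?rK wE.
Qed.

(** * Reflexivity and powers of a finite dimensional algebra *)

Section FinDimAlgebra.
Variables (K : fieldType) (L : falgType K).

Definition in_algc (k : K) : L^c := k%:A.

Lemma in_algc_additive : zmod_morphism in_algc.
Proof. by move=> a b; rewrite /in_algc scalerBl. Qed.

Lemma in_algc_multiplicative : monoid_morphism in_algc.
Proof.
split=> [|a b]; first exact: scale1r.
rewrite /in_algc -[RHS]/((b%:A : L) * (a%:A : L)).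
by rewrite mulr_algl scalerA mulrC.
Qed.

HB.instance Definition _ := GRing.isZmodMorphism.Build K L^c in_algc
  in_algc_additive.
HB.instance Definition _ := GRing.isMonoidMorphism.Build K L^c in_algc
  in_algc_multiplicative.

Lemma in_alg_central k (b : L) : in_alg L k * b = b * in_alg L k.
Proof. by rewrite /= mulr_algl mulr_algr. Qed.

Lemma in_algc_central k (b : L^c) : in_algc k * b = b * in_algc k.
Proof. exact: esym (in_alg_central k b). Qed.

(** [L] and [L^c] share a carrier, so the identity is the anti-isomorphism. This duality takes right
    modules to left ones; [right_dual_pair] goes back. *)
Definition left_dual_pair : dual_pair K L L^c :=
  @DualPair K L L^c (fun a => a) in_algc
    (fun a b => erefl) erefl (fun a b => erefl) in_algc_central.

Definition right_dual_pair : dual_pair K L^c L :=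
  @DualPair K L^c L (fun a => a) (in_alg L)
    (fun a b => erefl) erefl (fun a b => erefl) in_alg_central.

Let n := \dim {:L}.
Let e : n.-tuple L := vbasis {:L}.

Lemma vbasis_sum (x : L) : x = \sum_i coord e i x *: e`_i.
Proof. by apply: coord_vbasis; rewrite memvf. Qed.

Lemma fin_gen_converse : fin_gen (res_scalars in_algc (L^c)^o).
Proof.
exists n, (fun i => e`_i) => x; exists (fun i => coord e i x).
rewrite [LHS]vbasis_sum; apply: eq_bigr => i _.
by rewrite -[RHS]/(e`_i * (coord e i x)%:A) mulr_algr.
Qed.

Local Notation DL := (dual right_dual_pair L^o).

Lemma DL_scale (m : DL) k (x : L) : m (k *: x) = k * m x.
Proof. by rewrite -[k *: x]mulr_algl; exact: (dual_funZ m k x). Qed.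

Lemma DL_vbasis (m : DL) (x : L) : m x = \sum_i coord e i x * m e`_i.
Proof.
rewrite {1}[x]vbasis_sum -[LHS]/(dual_lin m _) linear_sum.
by apply: eq_bigr => i _; rewrite -DL_scale.
Qed.

(** A functional is determined by its values on a basis, which embeds [DL] in a finite power of
    [K]. *)
Lemma fin_gen_DL : fin_gen DL.
Proof.
apply: (@res_fin_gen K L^c in_algc).
pose h (m : res_scalars in_algc DL) : 'I_n -> K^o := fun i => m e`_i.
have lh : linear h.
  move=> a m m'; apply/funext => i.
  rewrite -[LHS]/((in_algc a *: (m : DL) + m') e`_i) dual_addE.
  by rewrite dual_scaleE; congr (_ + _); apply: dual_funZ.
have hI : injective (mklin lh).
  move=> m m' mm; apply: dual_ext => x; rewrite !DL_vbasis.
  by apply: eq_bigr => i _; congr (_ * _);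
    exact: (congr1 (fun u : 'I_n -> K^o => u i) mm).
have [r rK] := linear_retraction hI.
by apply: (fin_gen_surj (f := r)) (@free_fin_gen K n) => m; exists (h m).
Qed.

Lemma ex_coord_dual i : exists m : DL, forall x, m x = coord e i x.
Proof.
apply: ex_dual => [x y|k x]; first by rewrite linearD.
by rewrite -[_ *: x]/(k%:A * x) mulr_algl linearZ.
Qed.

Lemma DL_sum (m : DL) (F : 'I_n -> L) : m (\sum_i F i) = \sum_i m (F i).
Proof. exact: (linear_sum (dual_lin m)). Qed.

(** Expanding [m] in the dual basis [c] shows that [f] is evaluation at the vector with coordinates
    [f (c i)]. *)
Lemma double_dual (f : dual left_dual_pair DL) :
  exists x : L, forall m : DL, f m = m x.
Proof.
have [c cE] := choice ex_coord_dual.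
exists (\sum_(i < n) f (c i) *: e`_i) => m.
have mE : m = \sum_(i < n) in_algc (m e`_i) *: c i.
  apply: dual_ext => x; rewrite DL_vbasis.
  pose ev (m : DL) : K := m x.
  have evD : {morph ev : m m' / m + m'} by [].
  have ev0 : ev 0 = 0 by [].
  rewrite -[RHS]/(ev _) (big_morph ev evD ev0); apply: eq_bigr => i _.
  rewrite /ev dual_scaleE -[RHS]/(c i ((m e`_i)%:A * (x : L))).
  by rewrite mulr_algl DL_scale cE mulrC.
rewrite {1}mE -[LHS]/(dual_lin f _) linear_sum DL_sum.
apply: eq_bigr => i _; rewrite DL_scale.
by rewrite -[LHS]/(f (in_algc (m e`_i) *: c i)) [LHS]dual_funZ mulrC.
Qed.

Lemma DL_separates (x : L) : (forall m : DL, m x = 0) -> x = 0.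
Proof.
move=> x0; have [c cE] := choice ex_coord_dual.
rewrite [x]vbasis_sum big1 // => i _.
by have := x0 (c i); rewrite cE => ->; rewrite scale0r.
Qed.

(** With its converse, this trades maps into [L] for maps into the double dual, where the vanishing
    of Ext is available. *)
Lemma linear_to_double_dual (M : lmodType L) (f : {linear M -> L^o}) :
  exists g : {linear M -> dual left_dual_pair DL},
    forall x (m : DL), g x m = m (f x).
Proof.
have ex x : exists u : dual left_dual_pair DL, forall m : DL, u m = m (f x).
  by apply: ex_dual => // k m; rewrite dual_scaleE; exact: dual_funZ.
have [g gE] := choice ex.
have lg : linear g.
  move=> a x y; apply: dual_ext => m; rewrite dual_addE dual_scaleE !gE.
  by rewrite linearP dual_funD.
by exists (mklin lg).
Qed.

Lemma linear_from_double_dual (M : lmodType L)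
    (g : {linear M -> dual left_dual_pair DL}) :
  exists f : {linear M -> L^o}, forall x (m : DL), g x m = m (f x).
Proof.
have [f fE] := choice (fun x => double_dual (g x)).
have lf : linear (f : M -> L^o).
  move=> a x y; apply/eqP; rewrite -subr_eq0; apply/eqP/DL_separates => m.
  rewrite -[LHS]/(dual_lin m _) linearB /=.
  rewrite -fE linearP dual_addE dual_scaleE !fE [X in _ - X]dual_funD.
  by rewrite dual_scaleE subrr.
by exists (mklin lf).
Qed.

(* A K-linear map K^Q -> Q sending each delta_q to q induces an L-linear map
   L^Q -> Q, L being finite dimensional; it is onto, hence splits. *)
Lemma projective_product_retract (Q : lmodType L) : projective Q ->
  exists (I : Type) (j : I -> {linear Q -> L^o})
         (r : {linear (I -> L^o) -> Q}), forall x, r (j^~ x) = x.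
Proof.
move=> pQ; have [s sE] := ex_point_functional (res_scalars (in_alg L) Q).
pose F (f : Q -> L^o) i : Q -> K^o := fun q => coord e i (f q).
pose rf (f : Q -> L^o) : Q := \sum_(i < n) (e`_i : L) *: (s (F f i) : Q).
have sZ k u : s (k *: u) = k%:A *: (s u : Q) :> Q by rewrite linearZ.
have lr : linear rf.
  move=> a f g.
  (* The structure constants of left multiplication by [a] express the action of [a] on coordinate
     functions. *)
  have FE b : F (a *: f + g) b
      = \sum_(i < n) coord e b (a * e`_i) *: F f i + F g b.
    apply/funext => q; rewrite -[LHS]/(coord e b (a * f q + g q)) linearD.
    congr (_ + _); rewrite {1}[f q]vbasis_sum mulr_sumr linear_sum fct_sumE.
    by apply: eq_bigr => i _; rewrite -scalerAr linearZ /= mulrC.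
  rewrite /rf scaler_sumr.
  under eq_bigr => b _ do rewrite FE linearD linear_sum scalerDr.
  rewrite big_split; congr (_ + _) => /=.
  under eq_bigr => b _ do rewrite scaler_sumr.
  rewrite exchange_big; apply: eq_bigr => i _.
  rewrite scalerA {2}[a * e`_i]vbasis_sum scaler_suml.
  by apply: eq_bigr => b _; rewrite sZ scalerA mulr_algr.
have rf_unit x : rf (unit_fun L x) = x.
  have FE i : F (unit_fun L x) i = coord e i 1 *: unit_fun K x.
    apply/funext => q; rewrite scale_unit_funE /F /unit_fun.
    by case: (x == q); rewrite ?mulr1 ?mulr0 ?linear0.
  rewrite /rf; under eq_bigr => i _ do rewrite FE sZ sE scalerA mulr_algr.
  by rewrite -scaler_suml -vbasis_sum scale1r.
have rs : surj (mklin lr) by move=> x; exists (unit_fun L x); exact: rf_unit.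
have [h hE] := pQ _ _ (mklin lr) idfun rs.
have lh i : linear (fun x => h x i) by move=> a x y; rewrite linearP.
exists Q, (fun i => mklin (lh i)), (mklin lr) => x; exact: hE.
Qed.
End FinDimAlgebra.

(** Passing to kernels reduces to [k = 0], where a splitting of the differential into [C 0] makes
    [M] a retract of [C 0]. *)
Lemma resolution_split (R : pzRingType) k j (M : lmodType R)
    (C : nat -> lmodType R) (d : forall i, {linear C i.+1 -> C i})
    (e : {linear C 0%N -> M}) (r : {linear C k -> C k.+1}) :
  resolution k.+1 d e -> (forall i, (i <= k.+1)%N -> projective (C i)) ->
  (forall x, r (d k x) = x) -> resolved (fun=> @projective R) j k M.
Proof.
elim: k j M C d e r => [|k IHk] j M C d e r re pC rd /=.
  have [_ es de _] := re.
  (* The identity minus [d r] vanishes on the image of [d], so it descends to a section [t] of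
     [e]. *)
  have [|t tE] := linear_descend
      (h := idfun \- (d 0%N \o r) : {linear C 0%N -> C 0%N}) es.
    by move=> _ /de[y <-]; rewrite /= rd subrr.
  apply: (projective_retract (f := t) (g := e)) (pC 0%N isT) => y.
  have [x <-] := es y; rewrite tE /= linearB /= (_ : e (d _ _) = 0) ?subr0 //.
  by apply/de; exists (r x).
have [M' [f [e' [fe re']]]] := resolution_kernel re.
exists (C 0%N), M', f, e; split=> //; first exact: pC.
by apply: (IHk j.+1 M' _ _ e' r re') => // i; apply: (pC i.+1).
Qed.

(** * Bounding the finitistic dimension *)

Section FinitisticDimension.
Variables (K : fieldType) (L : falgType K).

(* P k.+1 is a retract of a power of L, so it suffices to extend maps to L. *)
Lemma ext_vanish_split k (P : nat -> lmodType L)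
    (d : forall i, {linear P i.+1 -> P i}) :
  projective (P k.+1) -> (forall x : P k.+2, x = 0) ->
  ext_vanish d k (dual (left_dual_pair L) (dual (right_dual_pair L) L^o)) ->
  exists r : {linear P k -> P k.+1}, forall x, r (d k x) = x.
Proof.
move=> pP P0 VL; have [I [j [r rE]]] := projective_product_retract pP.
have ext i : exists g : {linear P k -> L^o}, forall x, g (d k x) = j i x.
  have [f fE] := linear_to_double_dual (j i).
  have [|g gE] := VL f; first by move=> x; rewrite (P0 x) !linear0.
  have [h hE] := linear_from_double_dual g; exists h => x.
  apply/eqP; rewrite -subr_eq0; apply/eqP/DL_separates => m.
  by rewrite -[LHS]/(dual_lin m _) linearB /= -hE gE fE subrr.
have [g gE] := choice ext.
have lg : linear (fun x i => g i x : L^o).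
  by move=> a x y; apply/funext => i; rewrite linearP.
exists (r \o mklin lg : {linear P k -> P k.+1}) => x /=.
by rewrite -[RHS]rE; congr (r _); apply/funext => i; exact: gE.
Qed.

(** The bound is the threshold [b] of Ext vanishing at index 1. If [X] had projective dimension
    [k + 1 > b], its last differential would split and leave a resolution of length [k]. *)
Lemma finite_ddell_Findim :
  (exists n, resolved (@fg_deloops L^c) 1 n (dual (right_dual_pair L) L^o)) ->
  enat_finite (Findim L).
Proof.
move=> [n rDL].
have [b Vb] := @resolved_ext_vanish K L L^c (left_dual_pair L)
  (right_dual_pair L) (fun=> erefl) (fun=> erefl) (fun=> erefl) _ _ _ rDL.
rewrite /Findim /enat_sup enat_inf_finite; exists b => p [X].
rewrite /pdim => /enat_inf_Some[[C [d [e [re pC]]]] pmin].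
rewrite leqNgt; apply/negP => lt_bp.
case: p lt_bp re pC pmin => // k le_bk re pC pmin.
have [C0 _ _ dd] := re.
have cC : projective_complex d.
  split=> // i; have [/pC //|lt_ki] := leqP i k.+1.
  by apply: projective_trivial; apply: C0.
have [|r rE] := ext_vanish_split (pC k.+1 (leqnn _)) (C0 k.+2 (leqnn _))
    (Vb C d cC k le_bk _).
  by move=> i; rewrite addn1; apply: C0.
have := resolved_resolution (resolution_split 0 re pC rE).
by move=> /pmin; rewrite ltnn.
Qed.

End FinitisticDimension.

Theorem theorem5p2 (K : fieldType) (L : falgType K) :
  torsion_free_class (@finite_ddell L^c) /\
  ((forall M : lmodType L^c, fin_gen M -> finite_ddell M) ->
   enat_finite (Findim L)).
Proof.
have fd := fin_gen_converse L.
have noeth := @fin_gen_sub _ _ _ fd.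
have covers := @ex_projective_cover _ _ _ fd.
split; first exact: finite_ddell_torsion_free noeth covers.
(* The hypothesis is applied to the dual of the left regular module. *)
move=> all_finite; apply: finite_ddell_Findim.
by apply/(finite_ddellP noeth covers)/all_finite/fin_gen_DL.
Qed.
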